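(* Let $\mu_1,\mu_2$ be probability measures on $\mathbb{R}$ and $x\in\mathbb{R}$, and assume that the pair $(\mu_1,\mu_2)$ is smooth at $x$. Then there are some $s_{\mu,0}>0$ and $c_\mu>0$, which depend only on $(\mu_1,\mu_2)$ and $x$, such that for every $s$ with $0<s\le s_{\mu,0}$ and all pairs of probability measures $(\nu_1,\nu_2)$ on $\mathbb{R}$ with $d_L(\mu_j,\nu_j)<s$ for both $j=1,2$, the measure $\nu_1\boxplus\nu_2$ is (Lebesgue) absolutely continuous in a neighborhood of $x$, and $$|f_{\nu_1\boxplus\nu_2}(x)-f_{\mu_1\boxplus\mu_2}(x)|<c_\mu s,$$ where $f_{\nu_1\boxplus\nu_2}$ and $f_{\mu_1\boxplus\mu_2}$ are the densities of $\nu_1\boxplus\nu_2$ and $\mu_1\boxplus\mu_2$, respectively.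
   Context: Stieltjes transform: for a probability measure $\mu$ on $\mathbb{R}$, $m_\mu(z):=\int_{\mathbb{R}}\frac{\mu(dx)}{x-z}$, $z\in\mathbb{C}^+:=\{z:\Im z>0\}$. Free convolution and subordination functions: for probability measures $\mu_1,\mu_2$ on $\mathbb{R}$, the free (additive) convolution $\mu_1\boxplus\mu_2$ is the probability measure whose Stieltjes transform satisfies, for $z\in\mathbb{C}^+$, $$m_{\mu_1\boxplus\mu_2}(z)=m_{\mu_1}(\omega_1(z)),\quad m_{\mu_1\boxplus\mu_2}(z)=m_{\mu_2}(\omega_2(z)),\quad z-\frac{1}{m_{\mu_1\boxplus\mu_2}(z)}=\omega_1(z)+\omega_2(z),$$ where $\omega_1,\omega_2$ (the subordination functions of the pair $(\mu_1,\mu_2)$, uniquely determined) are analytic maps $\mathbb{C}^+\to\mathbb{C}^+$ with $\Im\omega_j(z)\ge\Im z$ and $\omega_j(z)=z+o(z)$ as $z\to\infty$ in each sector $\Im z>\kappa|\Re z|$, $\kappa>0$. Boundary values: for $x\in\mathbb{R}$, $\omega_j(x):=\lim_{\eta\downarrow0}\omega_j(x+i\eta)$. Smoothness: the pair $(\mu_1,\mu_2)$ is smooth at $x$ if (i) $\Im\omega_j(x)>0$ for $j=1,2$, and (ii) $k_\mu(x):=\frac{1}{m_{\mu_1}'(\omega_1(x))}+\frac{1}{m_{\mu_2}'(\omega_2(x))}-(x-\omega_1(x)-\omega_2(x))^2\neq0$. Lévy distance: $d_L(\mu,\nu)=\sup_t\inf\{s\ge0: F_\nu(t-s)-s\le F_\mu(t)\le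 F_\nu(t+s)+s\}$, where $F_\mu,F_\nu$ are the cumulative distribution functions. The value of a density of a free convolution at the point $x$ is understood as $f_{\nu_1\boxplus\nu_2}(x)=\pi^{-1}\lim_{\eta\downarrow0}\Im m_{\nu_1\boxplus\nu_2}(x+i\eta)$ (and likewise for $\mu_1\boxplus\mu_2$). *)

(* Defs.v *)
From HB Require Import structures.
From mathcomp Require Import all_boot all_order all_algebra.
From mathcomp Require Import complex.
From mathcomp Require Import all_classical all_reals all_analysis.

Set Implicit Arguments.
Unset Strict Implicit.
Unset Printing Implicit Defensive.

Import Order.TTheory GRing.Theory Num.Theory.
Import numFieldNormedType.Exports.

Local Open Scope classical_set_scope.
Local Open Scope ring_scope.
Local Open Scope complex_scope.

Notation Rprobability R := (probability (measurableTypeR R) R).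

Section FreeConvolution.
Context {R : realType}.
Implicit Types (mu nu : Rprobability R) (w : R[i] -> R[i]) (x : R) (z : R[i]).

Definition upper_half_plane : set R[i] := [set z | 0 < complex.Im z].

(* The library integrates real-valued functions only, so the integral of
   1 / (t - z) is taken separately on real and imaginary parts. *)
Definition stieltjes mu z : R[i] :=
  (\int[mu]_(t in setT) complex.Re (t%:C - z)^-1)
  +i* (\int[mu]_(t in setT) complex.Im (t%:C - z)^-1).

(* R[i] has no topology of its own; [R[i]^o] carries the one given by the
   modulus, and a limit or derivative taken there is the complex one. *)
Definition stieltjes_deriv mu z : R[i] :=
  derive1 (stieltjes mu : R[i] -> R[i]^o) z.

Definition analytic_on (D : set R[i]) w : Prop :=
  forall z, D z -> derivable (w : R[i]^o -> R[i]^o) z 1.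

(* The last clause is w z = z + o(z) as z tends to infinity in each sector. *)
Definition subordination_map w : Prop :=
  [/\ forall z, upper_half_plane z -> upper_half_plane (w z),
      analytic_on upper_half_plane w,
      forall z, upper_half_plane z -> complex.Im z <= complex.Im (w z)
    & forall kappa : R, 0 < kappa -> forall e : R, 0 < e ->
      exists M : R, forall z, kappa * `|complex.Re z| < complex.Im z ->
        M%:C <= `|z| -> `|w z - z| <= e%:C * `|z| ].

(* [mu] is the free convolution of [mu1] and [mu2], with subordination
   functions [w1] and [w2]; values of [w1], [w2] outside the upper half-plane
   play no role. *)
Definition subordination mu1 mu2 mu w1 w2 : Prop :=
  [/\ subordination_map w1, subordination_map w2
    & forall z, upper_half_plane z ->
      [/\ stieltjes mu z = stieltjes mu1 (w1 z),
          stieltjes mu z = stieltjes mu2 (w2 z)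
        & z - (stieltjes mu z)^-1 = w1 z + w2 z]].

Definition is_free_convolution mu1 mu2 mu : Prop :=
  exists w1 w2, subordination mu1 mu2 mu w1 w2.

Definition has_boundary_value w x : Prop :=
  cvg ((w (x +i* eta) : R[i]^o) @[eta --> 0^'+]).

Definition boundary_value w x : R[i] :=
  lim ((w (x +i* eta) : R[i]^o) @[eta --> 0^'+]).

Definition kfun mu1 mu2 x (b1 b2 : R[i]) : R[i] :=
  (stieltjes_deriv mu1 b1)^-1 + (stieltjes_deriv mu2 b2)^-1
  - (x%:C - b1 - b2) ^+ 2.

(* The boundary values have to be finite, and both derivatives nonzero, for
   k_mu(x) to be defined.  The latter must be spelled out because 0^-1 = 0:
   for two copies of the symmetric Bernoulli law both derivatives vanish at
   x = 0 and [kfun] is then nonzero, although the system determining the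
   subordination functions is degenerate there. *)
Definition smooth_at mu1 mu2 x : Prop :=
  exists mu w1 w2, subordination mu1 mu2 mu w1 w2 /\
    let b1 := boundary_value w1 x in
    let b2 := boundary_value w2 x in
    [/\ has_boundary_value w1 x /\ has_boundary_value w2 x,
        0 < complex.Im b1 /\ 0 < complex.Im b2,
        stieltjes_deriv mu1 b1 != 0 /\ stieltjes_deriv mu2 b2 != 0
      & kfun mu1 mu2 x b1 b2 != 0].

Definition dist_fun mu (t : R) : R := fine (mu `]-oo, t]%classic).

Definition levy_dist mu nu : R :=
  sup [set inf [set s | 0 <= s /\
                  dist_fun nu (t - s) - s <= dist_fun mu t
                    <= dist_fun nu (t + s) + s]
      | t in [set: R]].

Definition abs_continuous_near mu x : Prop :=
  exists (U : set (measurableTypeR R)) (mU : measurable U),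
    nbhs (x : R) U /\ mrestr mu mU `<< (@lebesgue_measure R).

Definition has_density_value mu x : Prop :=
  cvg (complex.Im (stieltjes mu (x +i* eta)) @[eta --> 0^'+]).

Definition density_value mu x : R :=
  pi^-1 * lim (complex.Im (stieltjes mu (x +i* eta)) @[eta --> 0^'+]).

End FreeConvolution.

(* Main.v *)
From HB Require Import structures.
Require Import Defs.
From mathcomp Require Import all_boot all_order all_algebra.
From mathcomp Require Import complex ring lra.
From mathcomp Require Import all_classical all_reals all_analysis.
From mathcomp Require Import measurable_realfun.

(** The subordination functions at [z] form a solution [(w1, w2)] in the upper
    half-plane of the system
      [w2 = z + h1 w1],  [w1 = z + h2 w2],  where [hj w = - 1 / mj w - w]
    and [mj] is the Stieltjes transform of the [j]-th measure.  Eliminating [w2]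
    leaves one fixed-point equation [w1 = z + h2 (z + h1 w1)].  The theorem is
    the stability of its solution when the measures are perturbed and [z]
    approaches [x]; everything rests on divided differences of [mj] and [hj],
    which are explicit integrals, so no complex function theory is involved.

    - Uniqueness in the open half-plane ([subordination_unique]).  With
      [u t = 1 / ((t - w) m w)], of integral one, the divided difference of [h]
      at [w] and [w'] is the integral of [(u - 1) (u' - 1)]; Cauchy-Schwarz gives
      a Schwarz-Pick inequality, and at [Im z > 0] the fixed-point map is
      strictly contracting for it.  Hence any solution found by other means in
      the half-plane is the subordination function.
    - Perturbation of the measure ([levy_stieltjes]).  A monotone, bounded,
      Lipschitz function has integrals differing by [O(s)] against two measures
      at Levy distance less than [s], because its superlevel sets are half-lines.
      Resolvents and their products have increments dominated by those of the
      bounded increasing function [t / (1 + |t|)], so their real and imaginary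
      parts are differences of two such functions.
    - Solvability near the boundary point ([local_solution]).  The condition that
      [k_mu(x)] is nonzero says that the derivative [1 - h1' h2'] of the
      fixed-point equation does not vanish at the boundary value [b1]
      ([kfun_neq0]).  A Newton iteration with this derivative frozen contracts a
      fixed ball around [b1], for all [z] near [x], real [z] included, and all
      measures close to [mu1] and [mu2].  Its fixed point is Lipschitz in [z] and
      at distance [O(s)] from [b1] when [z = x].
    - Conclusion ([free_convolution_near]).  By uniqueness the fixed points are
      the values of the subordination function of the perturbed pair, which
      therefore has a boundary value at [x], within [O(s)] of [b1].  The Stieltjes
      transform of the free convolution stays bounded near [x], which by
      comparison with the Poisson kernel bounds the mass of intervals by a
      multiple of their length ([abs_continuous_of_bounded]). *)

Set Implicit Arguments.
Unset Strict Implicit.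
Unset Printing Implicit Defensive.

Import Order.TTheory GRing.Theory Num.Theory.
Import numFieldNormedType.Exports.
Import Normc.

Local Open Scope classical_set_scope.
Local Open Scope ring_scope.
Local Open Scope complex_scope.

Local Notation Re := (@complex.Re _).
Local Notation Im := (@complex.Im _).

(** * Modulus of a complex number and integrals of complex functions *)

Section ComplexModulus.
Context {R : realType}.
Implicit Types z w : R[i].

Lemma sqr_normcE z : normc z ^+ 2 = Re z ^+ 2 + Im z ^+ 2.
Proof. by case: z => a b; rewrite /normc /= sqr_sqrtr// addr_ge0// sqr_ge0. Qed.

Lemma normc_ge0 z : 0 <= normc z.
Proof. by case: z => a b; exact: sqrtr_ge0. Qed.

Lemma ler_normc_Re z : `|Re z| <= normc z.
Proof.
by rewrite -ler_sqr ?nnegrE ?normc_ge0// sqr_normcE real_normK ?num_real// lerDl sqr_ge0.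
Qed.

Lemma ler_normc_Im z : `|Im z| <= normc z.
Proof.
by rewrite -ler_sqr ?nnegrE ?normc_ge0// sqr_normcE real_normK ?num_real// lerDr sqr_ge0.
Qed.

Lemma ler_normcD z w : normc (z + w) <= normc z + normc w.
Proof. exact: le_normcD. Qed.

Lemma normc_distC z w : normc (z - w) = normc (w - z).
Proof. by rewrite -normcN opprB. Qed.

Lemma normc_dist_triangle v z w : normc (z - w) <= normc (z - v) + normc (v - w).
Proof. by rewrite -[X in normc X](subrKA v); exact: ler_normcD. Qed.

Lemma normc_real (x : R) : normc x%:C = `|x|.
Proof. by rewrite /= expr0n/= addr0 sqrtr_sqr. Qed.

Lemma normc_gt0 z : (0 < normc z) = (z != 0).
Proof.
rewrite lt0r normc_ge0 andbT; congr negb; apply/eqP/eqP => [/eq0_normc//|->].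
exact: normc0.
Qed.

Lemma normc_le_ReIm z : normc z <= `|Re z| + `|Im z|.
Proof.
rewrite -ler_sqr ?nnegrE ?normc_ge0 ?addr_ge0// sqr_normcE sqrrD !real_normK ?num_real//.
by rewrite addrAC lerDl mulrn_wge0// mulr_ge0.
Qed.

Lemma mulcJ z : z * (conjc z) = (normc z ^+ 2)%:C.
Proof.
rewrite sqr_normcE; case: z => a b; rewrite /= ; simpc.
by congr (_ +i* _); ring.
Qed.

Lemma normcJ z : normc (conjc z) = normc z.
Proof. by case: z => a b /=; rewrite sqrrN. Qed.

Lemma Re_realM (x : R) z : Re (x%:C * z) = x * Re z.
Proof. by case: z => a b /=; rewrite mul0r subr0. Qed.

Lemma conjc_realM (x : R) z : conjc (x%:C * z) = x%:C * conjc z.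
Proof. by rewrite rmorphM /= oppr0. Qed.

Lemma Re_mulc z w : Re (z * w) = Re z * Re w - Im z * Im w.
Proof. by case: z w => a b [c d]. Qed.

Lemma Im_mulc z w : Im (z * w) = Re z * Im w + Im z * Re w.
Proof. by case: z w => a b [c d]. Qed.

Lemma Re_addc z w : Re (z + w) = Re z + Re w.
Proof. by case: z w => a b [c d]. Qed.

Lemma Im_addc z w : Im (z + w) = Im z + Im w.
Proof. by case: z w => a b [c d]. Qed.

Lemma Re_oppc z : Re (- z) = - Re z. Proof. by case: z. Qed.
Lemma Im_oppc z : Im (- z) = - Im z. Proof. by case: z. Qed.

Lemma Im_invc z : Im z^-1 = - Im z / normc z ^+ 2.
Proof. by rewrite sqr_normcE; case: z => a b /=; rewrite mulNr. Qed.

Lemma eqcP z w : Re z = Re w -> Im z = Im w -> z = w.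
Proof. by case: z w => a b [c d] /= -> ->. Qed.

End ComplexModulus.

Local Arguments normc : simpl never.

Section ComplexIntegral.
Context {R : realType}.
Implicit Types (mu : Rprobability R) (f g : R -> R[i]).

Definition cintegral mu f : R[i] :=
  (\int[mu]_(t in setT) Re (f t)) +i* (\int[mu]_(t in setT) Im (f t)).

Definition bounded_measurable f : Prop :=
  [/\ measurable_fun (setT : set (measurableTypeR R)) (fun t => Re (f t)),
      measurable_fun (setT : set (measurableTypeR R)) (fun t => Im (f t))
    & exists M, forall t, normc (f t) <= M].

Lemma bounded_integrable mu (f : R -> R) M :
  measurable_fun (setT : set (measurableTypeR R)) f -> (forall t, `|f t| <= M) ->
  mu.-integrable setT (EFin \o f).
Proof.
move=> mf fM; apply: measurable_bounded_integrable => //.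
  by rewrite (le_lt_trans (probability_le1 _ _))// ltry.
exists M; split; first exact: num_real.
by move=> A MA t _ /=; rewrite (le_trans (fM t))// ltW.
Qed.

Lemma bounded_measurableD f g :
  bounded_measurable f -> bounded_measurable g ->
  bounded_measurable (fun t => f t + g t).
Proof.
move=> [rf if_ [M fM]] [rg ig [N gN]]; split.
- by under eq_fun do rewrite Re_addc; exact: measurable_funD.
- by under eq_fun do rewrite Im_addc; exact: measurable_funD.
- by exists (M + N) => t; rewrite (le_trans (ler_normcD _ _))// lerD.
Qed.

Lemma bounded_measurableM f g :
  bounded_measurable f -> bounded_measurable g ->
  bounded_measurable (fun t => f t * g t).
Proof.
move=> [rf if_ [M fM]] [rg ig [N gN]]; split.
- under eq_fun do rewrite Re_mulc.
  by apply: measurable_funB; exact: measurable_funM.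
- under eq_fun do rewrite Im_mulc.
  by apply: measurable_funD; exact: measurable_funM.
- by exists (M * N) => t; rewrite normcM ler_pM// normc_ge0.
Qed.

Lemma bounded_measurable_cst (c : R[i]) : bounded_measurable (fun=> c).
Proof.
split; [exact: measurable_cst..|].
by exists (normc c).
Qed.

Lemma bounded_measurableJ f :
  bounded_measurable f -> bounded_measurable (fun t => conjc (f t)).
Proof.
move=> [rf if_ [M fM]]; split.
- by apply: eq_measurable_fun rf => t _; case: (f t).
- by apply: eq_measurable_fun (measurable_funN if_) => t _ /=; case: (f t).
- by exists M => t; rewrite normcJ.
Qed.

Lemma bounded_measurable_Re mu f : bounded_measurable f ->
  mu.-integrable setT (EFin \o (fun t => Re (f t))).
Proof.
move=> [rf _ [M fM]]; apply: (@bounded_integrable _ _ M) => // t.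
exact: le_trans (ler_normc_Re _) _.
Qed.

Lemma bounded_measurable_Im mu f : bounded_measurable f ->
  mu.-integrable setT (EFin \o (fun t => Im (f t))).
Proof.
move=> [_ rf [M fM]]; apply: (@bounded_integrable _ _ M) => // t.
exact: le_trans (ler_normc_Im _) _.
Qed.

Lemma cintegralD mu f g : bounded_measurable f -> bounded_measurable g ->
  cintegral mu (fun t => f t + g t) = cintegral mu f + cintegral mu g.
Proof.
move=> bf bg; apply: eqcP => /=.
  under eq_Rintegral do rewrite Re_addc.
  by rewrite RintegralD//; exact: bounded_measurable_Re.
under eq_Rintegral do rewrite Im_addc.
by rewrite RintegralD//; exact: bounded_measurable_Im.
Qed.

Lemma cintegralZ mu (c : R[i]) f : bounded_measurable f ->
  cintegral mu (fun t => c * f t) = c * cintegral mu f.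
Proof.
move=> bf; have iR := bounded_measurable_Re mu bf.
have iI := bounded_measurable_Im mu bf.
have sc k (h : R -> R) : mu.-integrable setT (EFin \o h) ->
    mu.-integrable setT (EFin \o (fun t => k * h t)).
  by move=> ih; exact: (@integrableZl _ _ _ mu setT measurableT k _ ih).
apply: eqcP; rewrite ?Re_mulc ?Im_mulc /=.
  under eq_Rintegral do rewrite Re_mulc.
  by rewrite RintegralB//; [rewrite !RintegralZl|exact: sc..].
under eq_Rintegral do rewrite Im_mulc.
by rewrite RintegralD//; [rewrite !RintegralZl|exact: sc..].
Qed.

Lemma cintegral_cst mu (c : R[i]) : cintegral mu (fun=> c) = c.
Proof.
apply: eqcP; rewrite /= Rintegral_cst//.
  by rewrite [X in fine X](_ : _ = 1%E) ?mulr1//; exact: probability_setT.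
by rewrite [X in fine X](_ : _ = 1%E) ?mulr1//; exact: probability_setT.
Qed.

Lemma eq_cintegral mu f g : f =1 g -> cintegral mu f = cintegral mu g.
Proof. by move=> fg; congr (cintegral mu _); exact/funext. Qed.

Lemma cintegralN mu f : bounded_measurable f ->
  cintegral mu (fun t => - f t) = - cintegral mu f.
Proof.
move=> bf; rewrite -mulN1r -cintegralZ//; apply: eq_cintegral => t.
by rewrite mulN1r.
Qed.

Lemma bounded_measurableN f :
  bounded_measurable f -> bounded_measurable (fun t => - f t).
Proof.
move=> bf; rewrite (_ : (fun t => _) = (fun t => (-1) * f t)).
  by apply: bounded_measurableM => //; exact: bounded_measurable_cst.
by apply/funext => t; rewrite mulN1r.
Qed.

Lemma bounded_measurableB f g :
  bounded_measurable f -> bounded_measurable g ->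
  bounded_measurable (fun t => f t - g t).
Proof.
by move=> bf bg; apply: bounded_measurableD => //; exact: bounded_measurableN.
Qed.

Lemma cintegralB mu f g : bounded_measurable f -> bounded_measurable g ->
  cintegral mu (fun t => f t - g t) = cintegral mu f - cintegral mu g.
Proof.
by move=> bf bg; rewrite cintegralD ?cintegralN//; exact: bounded_measurableN.
Qed.

(** Rotating the integral onto the positive axis reduces the bound to the
    monotonicity of real integrals. *)
Lemma ler_normc_cintegral mu f M : bounded_measurable f ->
  (forall t, normc (f t) <= M) -> normc (cintegral mu f) <= M.
Proof.
move=> bf fM; set I := cintegral mu f.
have M0 : 0 <= M := le_trans (normc_ge0 _) (fM 0).
have [->|I0] := eqVneq I 0; first by rewrite normc0.
have nI : 0 < normc I by rewrite normc_gt0.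
rewrite -(ler_pM2l nI) -expr2.
have -> : normc I ^+ 2 = Re (cintegral mu (fun t => conjc I * f t)).
  by rewrite cintegralZ// -/I mulrC mulcJ.
have bIf : bounded_measurable (fun t => conjc I * f t).
  by apply: bounded_measurableM => //; exact: bounded_measurable_cst.
have -> : normc I * M = \int[mu]_(t in setT) (normc I * M).
  rewrite Rintegral_cst// [X in fine X](_ : _ = 1%E) ?mulr1//.
  exact: probability_setT.
apply: le_Rintegral => //; first exact: bounded_measurable_Re.
  by apply: (@bounded_integrable _ _ (normc I * M)) => // t; rewrite ger0_norm// mulr_ge0// normc_ge0.
move=> t _; rewrite (le_trans (ler_norm _))// (le_trans (ler_normc_Re _))//.
by rewrite normcM normcJ ler_wpM2l// normc_ge0.
Qed.

(** Cauchy-Schwarz, from the nonnegativity of the integral of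
    [|f - c conjc g|^2] for every [c]. *)
Lemma cintegral_CauchySchwarz mu f g :
  bounded_measurable f -> bounded_measurable g ->
  normc (cintegral mu (fun t => f t * g t)) ^+ 2
    <= Re (cintegral mu (fun t => f t * conjc (f t)))
       * Re (cintegral mu (fun t => g t * conjc (g t))).
Proof.
move=> bf bg; have bfJ := bounded_measurableJ bf; have bgJ := bounded_measurableJ bg.
have bcst := bounded_measurable_cst.
have bM := bounded_measurableM.
set I := cintegral _ _; set A := Re _; set B := Re _.
have sqge0 h : 0 <= Re (cintegral mu (fun t => h t * conjc (h t))).
  by apply: Rintegral_ge0 => t _; rewrite mulcJ /= sqr_ge0.
have key (c : R[i]) : 0 <= A - 2 * Re (conjc c * I) + normc c ^+ 2 * B.
  have := sqge0 (fun t => f t - c * conjc (g t)).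
  suff -> : cintegral mu (fun t => (f t - c * conjc (g t)) * conjc (f t - c * conjc (g t))) =
     cintegral mu (fun t => f t * conjc (f t)) - cintegral mu (fun t => conjc c * (f t * g t))
     - conjc (cintegral mu (fun t => conjc c * (f t * g t)))
     + (normc c ^+ 2)%:C * cintegral mu (fun t => g t * conjc (g t)).
    rewrite cintegralZ; last exact: bM.
    rewrite !Re_addc !Re_oppc Re_realM -/A -/B -/I.
    have -> : Re (conjc (conjc c * I)) = Re (conjc c * I) by case: (conjc c * I).
    by rewrite mulr2n mulrDl mul1r opprD addrA.
  have -> : conjc (cintegral mu (fun t => conjc c * (f t * g t))) =
            cintegral mu (fun t => c * (conjc (f t) * conjc (g t))).
    apply: eqcP => /=.
      apply: eq_Rintegral => t _; rewrite -{2}[c]conjcK -!rmorphM.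
      by case: (conjc c * _).
    rewrite -mulN1r -RintegralZl//; last first.
      by apply: bounded_measurable_Im; do 2 apply: (bM) => //.
    apply: eq_Rintegral => t _; rewrite -{2}[c]conjcK -!rmorphM.
    by case: (conjc c * _) => ? ? /=; rewrite mulN1r.
  rewrite -cintegralZ; last exact: bM.
  rewrite -!cintegralB//; [|by do ?[apply: bounded_measurableB|apply: (bM)]..].
  rewrite -cintegralD//; [|by do ?[apply: bounded_measurableB|apply: (bM)]..].
  apply: eq_cintegral => t; rewrite -mulcJ rmorphB rmorphM /= conjcK.
  by ring.
have B0 : 0 <= B := sqge0 g.
(* The optimal choice is [c = I / B]; if [B = 0] a large multiple of [I] shows
   that [I = 0]. *)
have [Beq|BN] := eqVneq B 0; last first.
  have Bp : 0 < B by rewrite lt0r BN.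
  have := key ((B^-1)%:C * I).
  rewrite normcM normc_real gtr0_norm ?invr_gt0// conjc_realM -mulrA.
  rewrite (mulrC (conjc I)) mulcJ Re_realM /= => H.
  rewrite -ler_pdivrMr//.
  have E : (B^-1 * normc I) ^+ 2 * B = normc I ^+ 2 / B by field.
  rewrite E (mulrC B^-1) in H; lra.
rewrite Beq mulr0.
have A0 : 0 <= A := sqge0 f.
rewrite leNgt; apply/negP => Ip.
have := key (((A + 1) / (normc I ^+ 2))%:C * I).
rewrite Beq mulr0 addr0 conjc_realM -mulrA (mulrC (conjc I)) mulcJ Re_realM /=.
rewrite mulfVK ?gt_eqF//.
by move=> H; have : 0 <= A - 2 * (A + 1) := H; lra.
Qed.

End ComplexIntegral.

(** * Stieltjes transforms and the Schwarz-Pick inequality *)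

Section StieltjesTransform.
Context {R : realType}.
Implicit Types (mu : Rprobability R) (z w v : R[i]).

Definition resolvent w (t : R) : R[i] := (t%:C - w)^-1.

(** The divided difference of the Stieltjes transform of [mu]; on the diagonal
    it is the derivative. *)
Definition resolvent_product mu w v : R[i] :=
  cintegral mu (fun t => resolvent w t * resolvent v t).

Lemma resolvent_neq0 w t : 0 < Im w -> t%:C - w != 0.
Proof.
move=> w0; apply/eqP => /(congr1 Im); rewrite Im_addc Im_oppc /= sub0r => /eqP.
by rewrite oppr_eq0 gt_eqF.
Qed.

Lemma normc_resolvent w t : 0 < Im w -> normc (resolvent w t) <= (Im w)^-1.
Proof.
move=> w0; rewrite normcV lef_pV2 ?posrE ?normc_gt0 ?resolvent_neq0//.
have := ler_normc_Im (t%:C - w).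
by rewrite Im_addc Im_oppc /= sub0r normrN gtr0_norm.
Qed.

Lemma bounded_measurable_resolvent w :
  0 < Im w -> bounded_measurable (resolvent w).
Proof.
move=> w0.
pose d (t : R) := (t - Re w) ^+ 2 + Im w ^+ 2.
have d0 t : d t != 0 by rewrite gt_eqF// ltr_wpDl ?sqr_ge0// exprn_gt0.
have cid : continuous (fun t : R => t - Re w).
  by move=> t; apply: cvgB; [exact: cvg_id|exact: cvg_cst].
have cd : continuous d.
  move=> t; apply: cvgD; last exact: cvg_cst.
  by apply: (@cvgM _ _ _ _ (fun t => t - Re w)); exact: cid.
have cV : continuous (fun t => (d t)^-1) by move=> t; apply: cvgV; [exact: d0|exact: cd].
have Hd t : Re (t%:C - w) ^+ 2 + Im (t%:C - w) ^+ 2 = d t.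
  by rewrite Re_addc Re_oppc Im_addc Im_oppc /= sub0r sqrrN.
have RE t : Re (resolvent w t) = (t - Re w) * (d t)^-1.
  rewrite -Hd /resolvent; have : Re (t%:C - w) = t - Re w by rewrite Re_addc Re_oppc.
  by case: (_ - w) => a b /= ->.
have IE t : Im (resolvent w t) = Im w * (d t)^-1.
  by rewrite /resolvent Im_invc sqr_normcE Hd Im_addc Im_oppc /= sub0r opprK.
split.
- under eq_fun do rewrite RE.
  by apply: continuous_measurable_fun => t; apply: cvgM; [exact: cid|exact: cV].
- under eq_fun do rewrite IE.
  by apply: continuous_measurable_fun => t; apply: cvgM; [exact: cvg_cst|exact: cV].
- by exists (Im w)^-1 => t; exact: normc_resolvent.
Qed.

Lemma stieltjesE mu w : stieltjes mu w = cintegral mu (resolvent w).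
Proof. by []. Qed.

Lemma resolventB w v t : 0 < Im w -> 0 < Im v ->
  resolvent w t - resolvent v t = (w - v) * (resolvent w t * resolvent v t).
Proof.
move=> w0 v0; rewrite /resolvent; field.
by rewrite !resolvent_neq0.
Qed.

Lemma stieltjesB mu w v : 0 < Im w -> 0 < Im v ->
  stieltjes mu w - stieltjes mu v = (w - v) * resolvent_product mu w v.
Proof.
move=> w0 v0; have bw := bounded_measurable_resolvent w0.
have bv := bounded_measurable_resolvent v0.
rewrite !stieltjesE -cintegralB// -cintegralZ; last exact: bounded_measurableM.
by apply: eq_cintegral => t; rewrite resolventB.
Qed.

Lemma normc_stieltjes mu w : 0 < Im w -> normc (stieltjes mu w) <= (Im w)^-1.
Proof.
move=> w0; apply: ler_normc_cintegral => [|t]; last exact: normc_resolvent.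
exact: bounded_measurable_resolvent.
Qed.

Lemma Im_stieltjes mu w : 0 < Im w ->
  Im (stieltjes mu w) =
  Im w * Re (cintegral mu (fun t => resolvent w t * conjc (resolvent w t))).
Proof.
move=> w0; have bw := bounded_measurable_resolvent w0.
have bJ := bounded_measurableJ bw.
rewrite /= -RintegralZl//; last first.
  by apply: bounded_measurable_Re; exact: bounded_measurableM.
apply: eq_Rintegral => t _; rewrite mulcJ /= Im_invc normcV Im_addc Im_oppc /= sub0r opprK.
by rewrite exprVn.
Qed.

(** The Poisson kernel is positive everywhere, so its integral can vanish only
    if the whole line is a null set. *)
Lemma Im_stieltjes_gt0 mu w : 0 < Im w -> 0 < Im (stieltjes mu w).
Proof.
move=> w0; have bw := bounded_measurable_resolvent w0.
rewrite Im_stieltjes// mulr_gt0// lt0r.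
have -> : Re (cintegral mu (fun t => resolvent w t * conjc (resolvent w t))) =
    \int[mu]_(t in setT) (normc (resolvent w t) ^+ 2).
  by apply: eq_Rintegral => t _; rewrite mulcJ.
rewrite Rintegral_ge0 ?andbT; last by move=> t _; exact: sqr_ge0.
apply/eqP => I0.
have bM := bounded_measurableM bw (bounded_measurableJ bw).
have [mf _ _] := bM.
have mn : measurable_fun (setT : set (measurableTypeR R))
    (fun t => normc (resolvent w t) ^+ 2).
  by apply: eq_measurable_fun mf => t _; rewrite mulcJ.
have in_ : mu.-integrable setT (EFin \o (fun t => normc (resolvent w t) ^+ 2)).
  apply: (@bounded_integrable _ _ _ ((Im w)^-1 ^+ 2)) => // t.
  rewrite ger0_norm ?sqr_ge0// lerXn2r ?nnegrE ?normc_ge0 ?invr_ge0 ?(ltW w0)//.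
  exact: normc_resolvent.
have E0 : (\int[mu]_(t in setT) `|((normc (resolvent w t) ^+ 2)%R)%:E| = 0)%E.
  have H := fineK (integrable_fin_num measurableT in_).
  transitivity ((0 : R)%:E); last by [].
  rewrite -[in RHS]I0; transitivity (\int[mu]_x (EFin \o (fun t : R => (normc (resolvent w t) ^+ 2)%R)) x)%E; last by rewrite -H.
  by apply: eq_integral => t _ /=; rewrite ger0_norm// sqr_ge0.
have /ae_eq_integral_abs : measurable_fun (setT : set (measurableTypeR R))
    (EFin \o (fun t => normc (resolvent w t) ^+ 2)) by exact/measurable_EFinP.
move=> /(_ mu measurableT)[/(_ E0) [N [mN N0 sN]] _].
have NT : N = setT.
  apply/seteqP; split => // t _; apply: sN => /= /(_ I) /eqP.
  rewrite eqe expf_eq0 /= gt_eqF// normc_gt0 /resolvent invr_eq0.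
  exact: resolvent_neq0.
have := probability_setT mu.
by move: N0; rewrite NT => -> /eqP; rewrite eqe eq_sym oner_eq0.
Qed.

Lemma stieltjes_neq0 mu w : 0 < Im w -> stieltjes mu w != 0.
Proof.
by move=> /(Im_stieltjes_gt0 mu) m0; apply/eqP => m; rewrite m ltxx in m0.
Qed.

(** The excess [F w - w] of the negative reciprocal [F] of the Stieltjes
    transform: subordination reads [w2 - z = excess mu1 w1] and
    [w1 - z = excess mu2 w2]. *)
Definition excess mu w : R[i] := - (stieltjes mu w)^-1 - w.

(** The divided difference of [excess mu]. *)
Definition excess_slope mu w v : R[i] :=
  resolvent_product mu w v / (stieltjes mu w * stieltjes mu v) - 1.

Lemma excessB mu w v : 0 < Im w -> 0 < Im v ->
  excess mu w - excess mu v = (w - v) * excess_slope mu w v.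
Proof.
move=> w0 v0; rewrite mulrBr mulr1 mulrA -stieltjesB// /excess; field.
by rewrite !stieltjes_neq0.
Qed.

(** Since [u = resolvent w / m w] has integral one, the integral of [|u - 1|^2]
    is that of [|u|^2] minus one. *)
Lemma Im_excess mu w : 0 < Im w ->
  Im (excess mu w) =
  Im w * Re (cintegral mu (fun t => ((stieltjes mu w)^-1 * resolvent w t - 1) *
                          conjc ((stieltjes mu w)^-1 * resolvent w t - 1))).
Proof.
move=> w0; have bw := bounded_measurable_resolvent w0.
have bJ := bounded_measurableJ bw.
set m := stieltjes mu w; have m0 : m != 0 by exact: stieltjes_neq0.
have bM := bounded_measurableM. have bc := @bounded_measurable_cst R.
set L := cintegral mu _.
have E : L = ((normc m ^+ 2)^-1)%:C *
   cintegral mu (fun t => resolvent w t * conjc (resolvent w t))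
   - cintegral mu (fun t => m^-1 * resolvent w t)
   - cintegral mu (fun t => conjc (m^-1 * resolvent w t)) + 1.
  rewrite -[X in _ = _ + X](cintegral_cst mu 1) -cintegralZ; last exact: bM.
  have b1 : bounded_measurable (fun t => m^-1 * resolvent w t) by exact: bM.
  have b2 := bounded_measurableJ b1.
  have b3 : bounded_measurable (fun t => ((normc m ^+ 2)^-1)%:C *
       (resolvent w t * conjc (resolvent w t))).
    by apply: (bM) => //; exact: bM.
  have b4 := bounded_measurableB b3 b1.
  rewrite -cintegralB// -cintegralB// -cintegralD//; last exact: bounded_measurableB.
  apply: eq_cintegral => t.
  have -> : conjc (m^-1 * resolvent w t - 1) = conjc m^-1 * conjc (resolvent w t) - 1.
    by move: m^-1 (resolvent w t) => [a b] [c d]; apply: eqcP => /=; ring.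
  rewrite rmorphM.
  have -> : ((normc m ^+ 2)^-1)%:C = m^-1 * conjc m^-1.
    by rewrite mulcJ normcV exprVn.
  by ring.
have EJ : Re (cintegral mu (fun t => conjc (m^-1 * resolvent w t))) =
          Re (cintegral mu (fun t => m^-1 * resolvent w t)).
  by apply: eq_Rintegral => t _; case: (m^-1 * _).
rewrite E !Re_addc !Re_oppc EJ cintegralZ// -stieltjesE -/m mulVf//.
rewrite Re_realM /= /excess Im_addc !Im_oppc -/m Im_invc mulNr opprK.
rewrite (Im_stieltjes mu w0) [Re (cintegral _ _)]/=; ring.
Qed.

Lemma Im_excess_ge0 mu w : 0 < Im w -> 0 <= Im (excess mu w).
Proof.
move=> w0; rewrite Im_excess// mulr_ge0// ?(ltW w0)//.
by apply: Rintegral_ge0 => t _; rewrite mulcJ /= sqr_ge0.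
Qed.

(** Schwarz-Pick for [excess mu].  With [u = resolvent w / m w], of integral
    one, the divided difference is the integral of [(u - 1) (u' - 1)], so
    Cauchy-Schwarz applies. *)
Lemma excess_slope_bound mu w v : 0 < Im w -> 0 < Im v ->
  normc (excess_slope mu w v) ^+ 2 <=
    (Im (excess mu w) / Im w) * (Im (excess mu v) / Im v).
Proof.
move=> w0 v0; rewrite !Im_excess//.
rewrite !(mulrC (Im _) (Re _)) !mulfK ?gt_eqF//.
have bw := bounded_measurable_resolvent w0.
have bv := bounded_measurable_resolvent v0.
have bM := bounded_measurableM. have bc := @bounded_measurable_cst R.
set m := stieltjes mu w; have m0 : m != 0 by exact: stieltjes_neq0.
set n := stieltjes mu v; have n0 : n != 0 by exact: stieltjes_neq0.
have b1 : bounded_measurable (fun t => m^-1 * resolvent w t) by exact: bM.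
have b2 : bounded_measurable (fun t => n^-1 * resolvent v t) by exact: bM.
have := cintegral_CauchySchwarz mu (bounded_measurableB b1 (bc 1))
  (bounded_measurableB b2 (bc 1)).
suff -> : cintegral mu (fun t => (m^-1 * resolvent w t - 1) * (n^-1 * resolvent v t - 1))
  = excess_slope mu w v by [].
have b3 : bounded_measurable (fun t => (m * n)^-1 * (resolvent w t * resolvent v t)).
  by apply: (bM) => //; exact: bM.
symmetry; transitivity (cintegral mu (fun t => (m * n)^-1 * (resolvent w t * resolvent v t))
   - cintegral mu (fun t => m^-1 * resolvent w t)
   - cintegral mu (fun t => n^-1 * resolvent v t) + cintegral mu (fun=> 1)).
  rewrite !cintegralZ ?cintegral_cst//; last exact: bM.
  by rewrite -!stieltjesE !mulVf// /excess_slope mulrC subrK.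
have b4 := bounded_measurableB b3 b1.
rewrite -cintegralB// -cintegralB// -cintegralD//; last exact: bounded_measurableB.
by apply: eq_cintegral => t; field; rewrite m0 n0.
Qed.

(** Two solutions differ by [d1] and [d2] with [d2 = Q1 d1] and [d1 = Q2 d2];
    Schwarz-Pick gives [|Q1 Q2| < 1] because [z] lies in the open half-plane. *)
Lemma subordination_unique mu1 mu2 z (w1 w2 v1 v2 : R[i]) :
  0 < Im z -> 0 < Im w1 -> 0 < Im w2 -> 0 < Im v1 -> 0 < Im v2 ->
  w2 = z + excess mu1 w1 -> w1 = z + excess mu2 w2 ->
  v2 = z + excess mu1 v1 -> v1 = z + excess mu2 v2 ->
  w1 = v1 /\ w2 = v2.
Proof.
move=> z0 w10 w20 v10 v20 hw2 hw1 hv2 hv1.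
set Q1 := excess_slope mu1 w1 v1; set Q2 := excess_slope mu2 w2 v2.
have d2 : w2 - v2 = (w1 - v1) * Q1.
  by rewrite -excessB// hw2 hv2; ring.
have d1 : w1 - v1 = (w2 - v2) * Q2.
  by rewrite -excessB// hw1 hv1; ring.
suff E : w1 = v1 by split => //; apply/eqP; rewrite -subr_eq0 d2 E subrr mul0r.
have I1 : Im (excess mu1 w1) = Im w2 - Im z by rewrite hw2 (Im_addc z) addrAC subrr add0r.
have I1' : Im (excess mu1 v1) = Im v2 - Im z by rewrite hv2 (Im_addc z) addrAC subrr add0r.
have I2 : Im (excess mu2 w2) = Im w1 - Im z by rewrite hw1 (Im_addc z) addrAC subrr add0r.
have I2' : Im (excess mu2 v2) = Im v1 - Im z by rewrite hv1 (Im_addc z) addrAC subrr add0r.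
have := Im_excess_ge0 mu1 w10; rewrite I1 => p1.
have := Im_excess_ge0 mu1 v10; rewrite I1' => p1'.
have := Im_excess_ge0 mu2 w20; rewrite I2 => p2.
have := Im_excess_ge0 mu2 v20; rewrite I2' => p2'.
have := excess_slope_bound mu1 w10 v10; rewrite I1 I1' -/Q1 => B1.
have := excess_slope_bound mu2 w20 v20; rewrite I2 I2' -/Q2 => B2.
have QQ : normc (Q1 * Q2) ^+ 2 < 1.
  rewrite normcM exprMn.
  apply: le_lt_trans (ler_pM (sqr_ge0 _) (sqr_ge0 _) B1 B2) _.
  have r1 : 0 <= (Im w2 - Im z) / Im w2 < 1.
    by rewrite divr_ge0 ?(ltW w20)// ltr_pdivrMr// mul1r gtrBl.
  have r2 : 0 <= (Im v2 - Im z) / Im v2 < 1.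
    by rewrite divr_ge0 ?(ltW v20)// ltr_pdivrMr// mul1r gtrBl.
  have r3 : 0 <= (Im w1 - Im z) / Im w1 < 1.
    by rewrite divr_ge0 ?(ltW w10)// ltr_pdivrMr// mul1r gtrBl.
  have r4 : 0 <= (Im v1 - Im z) / Im v1 < 1.
    by rewrite divr_ge0 ?(ltW v10)// ltr_pdivrMr// mul1r gtrBl.
  have -> : (Im w2 - Im z) / Im w1 * ((Im v2 - Im z) / Im v1) *
    ((Im w1 - Im z) / Im w2 * ((Im v1 - Im z) / Im v2)) =
    ((Im w2 - Im z) / Im w2 * ((Im v2 - Im z) / Im v2)) *
    ((Im w1 - Im z) / Im w1 * ((Im v1 - Im z) / Im v1)).
    by field; rewrite !gt_eqF.
  move: r1 r2 r3 r4 => /andP[? ?] /andP[? ?] /andP[? ?] /andP[? ?].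
  by apply: mulr_ilt1; [exact: mulr_ge0|exact: mulr_ge0|exact: mulr_ilt1..].
apply/eqP; rewrite -subr_eq0; apply/eqP.
have : (w1 - v1) * (1 - Q1 * Q2) = 0 by rewrite mulrBr mulr1 mulrA -d2 -d1 subrr.
move=> /eqP; rewrite mulf_eq0 => /orP[/eqP//|/eqP/subr0_eq QQ1].
by rewrite -QQ1 normc1 expr1n ltxx in QQ.
Qed.

End StieltjesTransform.

(** * Levy distance and integrals of monotone functions *)

Section LevyDistance.
Context {R : realType}.
Implicit Types (mu nu : Rprobability R) (s t : R).

Lemma measurable_ray (b : bool) (t : R) :
  measurable ([set` Interval -oo%O (BSide b t)] : set (measurableTypeR R)).
Proof. exact: measurable_itv. Qed.

Lemma dist_funE mu t : mu `]-oo, t]%classic = (dist_fun mu t)%:E.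
Proof. by rewrite /dist_fun fineK// fin_num_measure. Qed.

Lemma dist_fun_ge0 mu t : 0 <= dist_fun mu t.
Proof. by rewrite fine_ge0. Qed.

Lemma dist_fun_le1 mu t : dist_fun mu t <= 1.
Proof. by rewrite -lee_fin -dist_funE probability_le1. Qed.

Lemma dist_fun_nd mu t t' : t <= t' -> dist_fun mu t <= dist_fun mu t'.
Proof.
move=> tt'; rewrite -lee_fin -!dist_funE le_measure ?inE//.
by apply: subset_itvl; rewrite bnd_simp.
Qed.

(** The half of the closeness relation of the Levy distance that bounds
    [dist_fun mu] from below; the other half is this one with the two measures
    exchanged. *)
Definition levy_below s mu nu : Prop :=
  forall t, dist_fun nu (t - s) - s <= dist_fun mu t.

Lemma levy_dist_lt mu nu s : levy_dist mu nu < s ->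
  [/\ 0 < s, levy_below s mu nu & levy_below s nu mu].
Proof.
set S := fun t => [set s | 0 <= s /\
  dist_fun nu (t - s) - s <= dist_fun mu t <= dist_fun nu (t + s) + s].
move=> ds.
have S1 t : S t 1.
  split => //; have := dist_fun_ge0 mu t; have := dist_fun_le1 mu t.
  have := dist_fun_ge0 nu (t + 1); have := dist_fun_le1 nu (t - 1).
  by move=> *; apply/andP; split; lra.
have infS t : inf (S t) < s.
  apply: le_lt_trans ds; apply: ub_le_sup; last by exists t.
  exists 1 => _ [u _ <-]; apply: ge_inf; last exact: S1.
  by exists 0 => v [].
have St t : exists2 v, S t v & v < s.
  by apply: inf_lt => //; exists 1.
have s0 : 0 < s by have [v [v0 _] vs] := St 0; exact: le_lt_trans vs.
split => // t.
- have [v [v0 /andP[H _]] vs] := St t; apply: le_trans H.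
  by apply: lerB; rewrite ?(ltW vs)//; apply: dist_fun_nd; rewrite lerB// ltW.
- have [v [v0 /andP[_ H]] vs] := St (t - s).
  rewrite lerBlDr; apply: le_trans H _.
  apply: lerD (ltW vs); apply: dist_fun_nd.
  by rewrite -lerBrDr lerB// ltW.
Qed.

(** The sets [{f > r}] are half-lines, which is what the distribution functions
    compare; moving the end point of the half-line by [s] changes [f] by at
    most [L s]. *)
Lemma levy_superlevel mu nu s (L : R) (f : R -> R) (r : R) :
  0 < s -> 0 <= L -> levy_below s mu nu ->
  {homo f : t t' / t <= t'} -> (forall t t', t <= t' -> f t' - f t <= L * (t' - t)) ->
  (mu [set t | (r < f t)%R] <= nu [set t | (r < f t + L * s)%R] + s%:E)%E.
Proof.
move=> s0 L0 mn fnd fL.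
have [A0|] := pselect (exists a, f a <= r); last first.
  move=> NA; have fr t : r < f t by rewrite ltNge; apply/negP => ?; apply: NA; exists t.
  rewrite [X in nu X](_ : _ = setT); last first.
    by apply/seteqP; split => // t _ /=; rewrite (lt_le_trans (fr t))// lerDl mulr_ge0// ltW.
  rewrite [nu _](probability_setT nu) (le_trans (probability_le1 _ _))//.
    rewrite [X in measurable X](_ : _ = setT)//.
    by apply/seteqP; split => // t _ /=.
  by rewrite leeDl// lee_fin ltW.
have [[e er]|NE] := pselect (exists e, r < f e); last first.
  rewrite [X in mu X](_ : _ = set0) ?measure0 ?adde_ge0//; first by rewrite lee_fin ltW.
  by apply/seteqP; split => // t /= ?; apply: NE; exists t.
pose A := [set t | f t <= r].
have Ae a : A a -> a <= e.
  move=> Aa; rewrite leNgt; apply/negP => /ltW /fnd ea.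
  by have := lt_le_trans er ea; rewrite ltNge Aa.
have hsA : has_sup A.
  by split; [case: A0 => a; exists a|exists e => a /Ae].
(* [f] is continuous, so [{f > r}] is the open half-line beyond [tau]. *)
pose tau := sup A.
have ftau : f tau <= r.
  rewrite leNgt; apply/negP => rf.
  have d0 : 0 < (f tau - r) / (L + 1) by rewrite divr_gt0 ?subr_gt0// ltr_wpDl.
  have [a Aa taua] := sup_adherent d0 hsA.
  have atau : a <= tau by exact: sup_upper_bound.
  have := fL _ _ atau.
  have : L * (tau - a) < f tau - r.
    apply: le_lt_trans (_ : (L + 1) * (tau - a) < _).
      by rewrite ler_wpM2r ?subr_ge0// lerDl.
    by rewrite mulrC -ltr_pdivlMr ?ltr_wpDl// ltrBlDr addrC -ltrBlDr.
  have : f a <= r := Aa.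
  lra.
have tauE t : (r < f t) = (tau < t).
  rewrite !ltNge; congr (~~ _); apply/idP/idP => [At|/fnd ftt].
    exact: sup_upper_bound.
  exact: le_trans ftau.
have -> : [set t | (r < f t)%R] = ~` `]-oo, tau]%classic.
  by apply/seteqP; split => t /=; rewrite in_itv/= tauE ltNge => /negP.
apply: (@le_trans _ _ (nu (~` `]-oo, (tau - s)%R]%classic) + s%:E)%E).
  rewrite !probability_setC//; try exact: measurable_ray.
  by rewrite !dist_funE -!EFinB -EFinD lee_fin; have := mn tau; lra.
rewrite leeD2r// le_measure ?inE//.
- by apply: measurableC; exact: measurable_ray.
- have -> : [set t | (r < f t + L * s)%R] = setT `&` (fun t => f t + L * s) @^-1` `]r, +oo[%classic.
    by apply/seteqP; split => t /=; rewrite in_itv/= andbT //; case.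
  suff mf : measurable_fun (setT : set (measurableTypeR R)) (fun t => f t + L * s).
    by apply: mf => //; exact: measurable_itv.
  apply: nondecreasing_measurable => // t t' tt'; rewrite lerD2r; exact: fnd.
- move=> t /=; rewrite in_itv/= => /negP; rewrite -ltNge ltrBlDr -tauE => H.
  apply: lt_le_trans H _.
  have := fL t (t + s); rewrite lerDl (ltW s0) addrAC subrr add0r => /(_ isT).
  lra.
Qed.

Lemma measurable_nd (f : R -> R) : {homo f : t t' / t <= t'} ->
  measurable_fun (setT : set (measurableTypeR R)) f.
Proof. by move=> fnd; exact: nondecreasing_measurable. Qed.

(** Layer-cake integration of the comparison of superlevel sets. *)
Lemma levy_integral_nd mu nu s (L M : R) (f : R -> R) :
  0 < s -> 0 <= L -> levy_below s mu nu ->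
  {homo f : t t' / t <= t'} -> (forall t t', t <= t' -> f t' - f t <= L * (t' - t)) ->
  (forall t, 0 <= f t <= M) ->
  \int[mu]_(t in setT) f t <= \int[nu]_(t in setT) f t + (L + M) * s.
Proof.
move=> s0 L0 mn fnd fL fM.
have M0 : 0 <= M by have /andP[] := fM 0; exact: le_trans.
have mf := measurable_nd fnd.
(* The shift of [f] by [L s] costs [L s] in the integral; the defect [s] in the
   measure of the superlevel sets is paid only at the levels below [M]. *)
pose g (t : R) : R := f t + L * s.
have gnd : {homo g : t t' / t <= t'} by move=> t t' tt'; rewrite lerD2r; exact: fnd.
have mg := measurable_nd gnd.
pose X : {RV mu >-> R} := HB.pack f (isMeasurableFun.Build _ _ (measurableTypeR R) R f mf).
pose Y : {RV nu >-> R} := HB.pack g (isMeasurableFun.Build _ _ (measurableTypeR R) R g mg).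
have iX : mu.-integrable setT (EFin \o f).
  by apply: (@bounded_integrable _ _ _ M) => // t; have /andP[? ?] := fM t; rewrite ger0_norm.
have iY : nu.-integrable setT (EFin \o g).
  apply: (@bounded_integrable _ _ _ (M + L * s)) => // t.
  by have /andP[? ?] := fM t; rewrite ger0_norm ?lerD2r// addr_ge0// mulr_ge0// ltW.
have iXn : nu.-integrable setT (EFin \o f).
  by apply: (@bounded_integrable _ _ _ M) => // t; have /andP[? ?] := fM t; rewrite ger0_norm.
have EX : ((\int[mu]_(t in setT) f t)%:E = 'E_mu[X])%E.
  rewrite expectation_def /Rintegral fineK//.
  exact: (integrable_fin_num measurableT iX).
have EY : ((\int[nu]_(t in setT) g t)%:E = 'E_nu[Y])%E.
  rewrite expectation_def /Rintegral fineK//.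
  exact: (integrable_fin_num measurableT iY).
have -> : \int[nu]_(t in setT) f t + (L + M) * s = \int[nu]_(t in setT) g t + M * s.
  rewrite RintegralD//; last by apply: (@bounded_integrable _ _ _ `|L * s|).
  rewrite Rintegral_cst// [X in fine X](_ : _ = 1%E) ?mulr1 ?mulrDl ?addrA//.
  exact: probability_setT.
rewrite -lee_fin EFinD EX EY !ge0_expectation_ccdf; last 2 first.
- by move=> t /=; have /andP[? ?] := fM t; rewrite addr_ge0// mulr_ge0// ltW.
- by move=> t /=; have /andP[] := fM t.
have -> : ((M * s)%:E = \int[lebesgue_measure]_(r in `[0%R, +oo[) (s * \1_`[0%R, M] r)%:E)%E.
  under eq_integral do rewrite EFinM.
  rewrite ge0_integralZl//; last 2 first.
  - by apply/measurable_EFinP; apply: measurable_indic.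
  - by rewrite lee_fin ltW.
  rewrite integral_indic// setIidl; last first.
    by move=> t /=; rewrite !in_itv/= => /andP[->].
  have E0M : (lebesgue_measure (`[0%R, M]%classic : set R) = M%:E)%E.
    rewrite lebesgue_measure_itv/= lte_fin; case: ltgtP M0 => // [_|<-] _;
      by rewrite ?sube0.
  by rewrite EFinM muleC; congr (_ * _)%E; exact: esym E0M.
rewrite -ge0_integralD//; last 3 first.
- by apply: measurable_funTS; exact: ccdf_measurable.
- by move=> r _; rewrite lee_fin mulr_ge0// ltW.
- by apply/measurable_EFinP; apply: measurable_funM.
apply: ge0_le_integral => //.
- by apply: measurable_funTS; exact: ccdf_measurable.
- apply: emeasurable_funD; first by apply: measurable_funTS; exact: ccdf_measurable.
  by apply/measurable_EFinP; apply: measurable_funM.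
move=> r; rewrite /= in_itv/= andbT => r0.
have pre (P : Rprobability R) (h : R -> R) : (P (h @^-1` `]r, +oo[%classic) = P [set t | (r < h t)%R])%E.
  by congr (P _); apply/seteqP; split => t /=; rewrite in_itv/= andbT.
rewrite /ccdf /distribution /pushforward /= !pre.
have [rM|Mr] := leP r M.
  by rewrite indicE mem_set ?mulr1 /= ?in_itv/= ?r0//; exact: levy_superlevel.
rewrite [X in (mu X <= _)%E](_ : _ = set0) ?measure0 ?adde_ge0//.
  by rewrite lee_fin mulr_ge0// ltW.
apply/seteqP; split => // t /= rf; have /andP[_] := fM t.
by rewrite leNgt (lt_trans Mr rf).
Qed.

End LevyDistance.

(** * Levy distance and Stieltjes transforms *)

Section BoundedVariation.
Context {R : realType}.
Implicit Types (mu nu : Rprobability R) (s t : R).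

(** A bounded increasing function whose increments dominate those of every
    resolvent. *)
Definition squash t : R := t / (1 + `|t|).

Let onenorm_gt0 t : 0 < 1 + `|t|. Proof. by rewrite ltr_pwDl. Qed.

Lemma squash_norm_le1 t : `|squash t| <= 1.
Proof.
rewrite normrM normfV [`|1 + _|]gtr0_norm// ler_pdivrMr// mul1r.
by rewrite lerDr.
Qed.

Lemma squash_diff_ge t t' : t <= t' ->
  (t' - t) / ((1 + `|t|) * (1 + `|t'|)) <= squash t' - squash t.
Proof.
move=> tt'; rewrite ler_pdivrMr ?mulr_gt0//.
have -> : (squash t' - squash t) * ((1 + `|t|) * (1 + `|t'|)) =
  t' * (1 + `|t|) - t * (1 + `|t'|).
  by rewrite /squash; field; rewrite !gt_eqF.
by case: (ger0P t) => ?; case: (ger0P t') => ?; nra.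
Qed.

Lemma squash_diff_le t t' : t <= t' -> squash t' - squash t <= t' - t.
Proof.
move=> tt'.
have -> : squash t' - squash t =
  (t' * (1 + `|t|) - t * (1 + `|t'|)) / ((1 + `|t|) * (1 + `|t'|)).
  by rewrite /squash; field; rewrite !gt_eqF.
rewrite ler_pdivrMr ?mulr_gt0//.
have : 0 <= (t' - t) * (`|t| * `|t'|) by rewrite mulr_ge0 ?subr_ge0// mulr_ge0.
by case: (ger0P t) => ?; case: (ger0P t') => ?; nra.
Qed.

(** A function whose increments are dominated by those of [K squash] is half
    the difference of the monotone functions [K squash + g] and
    [K squash - g]. *)
Lemma levy_integral_bv mu nu s (K G : R) (g : R -> R) :
  levy_dist mu nu < s -> 0 <= K -> (forall t, `|g t| <= G) ->
  (forall t t', `|g t - g t'| <= K * (`|t - t'| / ((1 + `|t|) * (1 + `|t'|)))) ->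
  measurable_fun (setT : set (measurableTypeR R)) g /\
  `|\int[mu]_(t in setT) g t - \int[nu]_(t in setT) g t| <= (4 * K + 2 * G) * s.
Proof.
move=> /levy_dist_lt[s0 mn nm] K0 gG gK.
have dg t t' : t <= t' -> `|g t' - g t| <= K * (squash t' - squash t).
  move=> tt'; apply: le_trans (gK _ _) _; rewrite ler_wpM2l//.
  apply: le_trans (squash_diff_ge tt').
  by rewrite ger0_norm ?subr_ge0// (mulrC (1 + `|t'|)).
pose f1 (t : R) : R := K * squash t + g t + (K + G).
pose f2 (t : R) : R := K * squash t - g t + (K + G).
have fnd1 : {homo f1 : t t' / t <= t'}.
  by move=> t t' /dg; rewrite /f1 ler_norml => /andP[? ?]; lra.
have fnd2 : {homo f2 : t t' / t <= t'}.
  by move=> t t' /dg; rewrite /f2 ler_norml => /andP[? ?]; lra.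
have sK t : `|K * squash t| <= K.
  by rewrite normrM ger0_norm// ler_piMr// squash_norm_le1.
have f1B t : 0 <= f1 t <= 2 * (K + G).
  have := sK t; have := gG t; rewrite /f1 !ler_norml => /andP[? ?] /andP[? ?].
  by apply/andP; split; lra.
have f2B t : 0 <= f2 t <= 2 * (K + G).
  have := sK t; have := gG t; rewrite /f2 !ler_norml => /andP[? ?] /andP[? ?].
  by apply/andP; split; lra.
have KL t t' : t <= t' -> K * (squash t' - squash t) <= K * (t' - t).
  by move=> tt'; rewrite ler_wpM2l//; exact: squash_diff_le.
have f1L t t' : t <= t' -> f1 t' - f1 t <= (2 * K) * (t' - t).
  move=> tt'; have := dg _ _ tt'; have := KL _ _ tt'.
  by rewrite /f1 ler_norml => ? /andP[? ?]; lra.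
have f2L t t' : t <= t' -> f2 t' - f2 t <= (2 * K) * (t' - t).
  move=> tt'; have := dg _ _ tt'; have := KL _ _ tt'.
  by rewrite /f2 ler_norml => ? /andP[? ?]; lra.
have K20 : 0 <= 2 * K by rewrite mulr_ge0.
have m1 := measurable_nd fnd1; have m2 := measurable_nd fnd2.
have gE : g = (fun t => 2^-1 * (f1 t - f2 t)).
  by apply/funext => t; rewrite /f1 /f2; field.
have i1 (P : Rprobability R) : P.-integrable setT (EFin \o f1).
  by apply: (@bounded_integrable _ _ _ (2 * (K + G))) => // t; have /andP[? ?] := f1B t; rewrite ger0_norm.
have i2 (P : Rprobability R) : P.-integrable setT (EFin \o f2).
  by apply: (@bounded_integrable _ _ _ (2 * (K + G))) => // t; have /andP[? ?] := f2B t; rewrite ger0_norm.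
have Ig (P : Rprobability R) : \int[P]_(t in setT) g t =
    2^-1 * (\int[P]_(t in setT) f1 t - \int[P]_(t in setT) f2 t).
  rewrite [in LHS]gE RintegralZl//.
    by rewrite RintegralB//; [exact: i1|exact: i2].
  exact: (@integrableB _ _ _ P setT measurableT _ _ (i1 P) (i2 P)).
split.
  rewrite gE; apply: measurable_funM => //; exact: measurable_funB.
have a1 := levy_integral_nd s0 K20 mn fnd1 f1L f1B.
have a2 := levy_integral_nd s0 K20 mn fnd2 f2L f2B.
have a3 := levy_integral_nd s0 K20 nm fnd1 f1L f1B.
have a4 := levy_integral_nd s0 K20 nm fnd2 f2L f2B.
by rewrite !Ig ler_norml; apply/andP; split; lra.
Qed.

Lemma levy_cintegral mu nu s (K G : R) (f : R -> R[i]) :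
  levy_dist mu nu < s -> 0 <= K -> (forall t, normc (f t) <= G) ->
  (forall t t', normc (f t - f t') <= K * (`|t - t'| / ((1 + `|t|) * (1 + `|t'|)))) ->
  normc (cintegral mu f - cintegral nu f) <= 2 * (4 * K + 2 * G) * s.
Proof.
move=> ds K0 fG fK.
have [|t t'|_ dR] := @levy_integral_bv mu nu s K G (fun t => Re (f t)) ds K0.
- by move=> t; exact: le_trans (ler_normc_Re _) (fG t).
- by apply: le_trans (fK t t'); apply: le_trans (ler_normc_Re _); rewrite Re_addc Re_oppc.
have [|t t'|_ dI] := @levy_integral_bv mu nu s K G (fun t => Im (f t)) ds K0.
- by move=> t; exact: le_trans (ler_normc_Im _) (fG t).
- by apply: le_trans (fK t t'); apply: le_trans (ler_normc_Im _); rewrite Im_addc Im_oppc.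
apply: le_trans (normc_le_ReIm _) _.
rewrite Re_addc Im_addc Re_oppc Im_oppc /=.
by rewrite -mulrA mulr2n mulrDl mul1r; exact: lerD.
Qed.

Lemma resolvent_decay (a rho : R) w t : 0 < a -> a <= Im w -> normc w <= rho ->
  normc (resolvent w t) <= ((1 + rho) / a + 1) / (1 + `|t|).
Proof.
move=> a0 aw wr; have w0 : 0 < Im w := lt_le_trans a0 aw.
have n0 : 0 < normc (t%:C - w) by rewrite normc_gt0 resolvent_neq0.
rewrite normcV ler_pdivlMr// mulrC ler_pdivrMr//.
have an : a <= normc (t%:C - w).
  apply: le_trans aw _; have := ler_normc_Im (t%:C - w).
  by rewrite Im_addc Im_oppc /= sub0r normrN gtr0_norm.
have tn : `|t| <= normc (t%:C - w) + rho.
  rewrite -normc_real; apply: le_trans (lerD (lexx _) wr).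
  by rewrite -[X in normc X <= _](subrK w); exact: ler_normcD.
have r0 : 0 <= rho := le_trans (normc_ge0 _) wr.
have : 1 + rho <= (1 + rho) / a * normc (t%:C - w).
  by rewrite mulrAC ler_pdivlMr// ler_wpM2l// addr_ge0.
rewrite [in leRHS]mulrDl mul1r; lra.
Qed.

Lemma resolvent_diff (a rho : R) w t t' : 0 < a -> a <= Im w -> normc w <= rho ->
  normc (resolvent w t - resolvent w t') <=
    ((1 + rho) / a + 1) ^+ 2 * (`|t - t'| / ((1 + `|t|) * (1 + `|t'|))).
Proof.
move=> a0 aw wr; have w0 : 0 < Im w := lt_le_trans a0 aw.
have -> : resolvent w t - resolvent w t' =
   (t' - t)%:C * (resolvent w t * resolvent w t').
  rewrite /resolvent rmorphB /=; field.
  by rewrite !resolvent_neq0.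
rewrite !normcM normc_real distrC.
have := ler_pM (normc_ge0 _) (normc_ge0 _) (resolvent_decay t a0 aw wr)
  (resolvent_decay t' a0 aw wr) => H.
apply: le_trans (ler_wpM2l (normr_ge0 _) H) _.
rewrite le_eqVlt; apply/orP; left; apply/eqP; field.
by rewrite !gt_eqF.
Qed.

(** Both transforms move by [O(s)] when the measure moves by [s] in the Levy
    distance, uniformly over measures and over bounded sets bounded away from
    the real axis. *)
Lemma levy_stieltjes (a rho : R) : 0 < a -> 0 <= rho -> exists2 C : R, 0 <= C &
  forall s mu nu, levy_dist mu nu < s ->
  (forall w, a <= Im w -> normc w <= rho ->
    normc (stieltjes mu w - stieltjes nu w) <= C * s) /\
  (forall w v, a <= Im w -> normc w <= rho -> a <= Im v -> normc v <= rho ->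
    normc (resolvent_product mu w v - resolvent_product nu w v) <= C * s).
Proof.
move=> a0 r0; pose k := ((1 + rho) / a + 1) ^+ 2.
have k0 : 0 <= k by exact: sqr_ge0.
have ai0 : 0 <= a^-1 by rewrite invr_ge0 ltW.
have rb w t : a <= Im w -> normc (resolvent w t) <= a^-1.
  move=> aw; have w0 : 0 < Im w := lt_le_trans a0 aw.
  by apply: le_trans (normc_resolvent t w0) _; rewrite lef_pV2.
pose C1 := 2 * (4 * k + 2 * a^-1).
pose C2 := 2 * (4 * (2 * (a^-1 * k)) + 2 * (a^-1 * a^-1)).
have C10 : 0 <= C1 by rewrite !(mulr_ge0, addr_ge0).
have C20 : 0 <= C2 by rewrite !(mulr_ge0, addr_ge0).
exists (C1 + C2) => [|s mu nu ds]; first exact: addr_ge0.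
have s0 : 0 <= s by have [/ltW] := levy_dist_lt ds.
split => [w aw wr|w v aw wr av vr].
  apply: (@le_trans _ _ (C1 * s)); last by rewrite ler_wpM2r// lerDl.
  apply: levy_cintegral => // [t|t t']; first exact: rb.
  exact: resolvent_diff.
apply: (@le_trans _ _ (C2 * s)); last by rewrite ler_wpM2r// lerDr.
apply: levy_cintegral => //; first by rewrite mulr_ge0// mulr_ge0.
  by move=> t; rewrite normcM; apply: ler_pM; rewrite ?normc_ge0//; exact: rb.
move=> t t'; pose q := `|t - t'| / ((1 + `|t|) * (1 + `|t'|)); rewrite -/q.
have -> : resolvent w t * resolvent v t - resolvent w t' * resolvent v t' =
  resolvent w t * (resolvent v t - resolvent v t') +
  resolvent v t' * (resolvent w t - resolvent w t') by ring.
apply: le_trans (ler_normcD _ _) _; rewrite !normcM.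
have -> : 2 * (a^-1 * k) * q = a^-1 * (k * q) + a^-1 * (k * q) by ring.
by apply: lerD; apply: ler_pM; rewrite ?normc_ge0//; [exact: rb|exact: resolvent_diff|exact: rb|exact: resolvent_diff].
Qed.

End BoundedVariation.

(** * Stability of the excess function and of its divided difference *)

Section LocalStability.
Context {R : realType}.
Implicit Types (mu nu : Rprobability R) (w v b : R[i]).

Lemma normc_resolvent_product mu (a : R) w v : 0 < a -> a <= Im w -> a <= Im v ->
  normc (resolvent_product mu w v) <= a^-1 * a^-1.
Proof.
move=> a0 aw av; have w0 := lt_le_trans a0 aw; have v0 := lt_le_trans a0 av.
apply: ler_normc_cintegral.
  by apply: bounded_measurableM; exact: bounded_measurable_resolvent.
move=> t; rewrite normcM; apply: ler_pM; rewrite ?normc_ge0//.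
  by apply: le_trans (normc_resolvent t w0) _; rewrite lef_pV2.
by apply: le_trans (normc_resolvent t v0) _; rewrite lef_pV2.
Qed.

Lemma resolvent_product_lip mu (a : R) w v b : 0 < a ->
  a <= Im w -> a <= Im v -> a <= Im b ->
  normc (resolvent_product mu w v - resolvent_product mu b b) <=
    a^-1 ^+ 3 * (normc (w - b) + normc (v - b)).
Proof.
move=> a0 aw av ab.
have w0 := lt_le_trans a0 aw; have v0 := lt_le_trans a0 av.
have b0 := lt_le_trans a0 ab.
have bw := bounded_measurable_resolvent w0.
have bv := bounded_measurable_resolvent v0.
have bb := bounded_measurable_resolvent b0.
have bM := @bounded_measurableM R.
rewrite -cintegralB; [|exact: bM..].
apply: ler_normc_cintegral; first by apply: bounded_measurableB; exact: bM.
have rb u t : a <= Im u -> normc (resolvent u t) <= a^-1.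
  move=> au; have u0 : 0 < Im u := lt_le_trans a0 au.
  by apply: le_trans (normc_resolvent t u0) _; rewrite lef_pV2.
have rl u t : a <= Im u -> normc (resolvent u t - resolvent b t) <=
    a^-1 * (a^-1 * normc (u - b)).
  move=> au; rewrite resolventB//; last exact: lt_le_trans au.
  rewrite normcM mulrC normcM [leRHS]mulrA; apply: ler_pM; rewrite ?normc_ge0//.
    by rewrite mulr_ge0 ?normc_ge0.
  by apply: ler_pM; rewrite ?normc_ge0//; exact: rb.
move=> t.
have -> : resolvent w t * resolvent v t - resolvent b t * resolvent b t =
  resolvent v t * (resolvent w t - resolvent b t) +
  resolvent b t * (resolvent v t - resolvent b t) by ring.
apply: le_trans (ler_normcD _ _) _; rewrite !normcM mulrDr exprS -!mulrA.
by apply: lerD; apply: ler_pM; rewrite ?normc_ge0//;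
  [exact: rb|exact: rl|exact: rb|exact: rl].
Qed.

Lemma normc_invB (M : R) w v : 0 < M -> M <= normc w -> M <= normc v ->
  normc (w^-1 - v^-1) <= M^-1 ^+ 2 * normc (w - v).
Proof.
move=> M0 Mw Mv.
have w0 : w != 0 by rewrite -normc_gt0 (lt_le_trans M0).
have v0 : v != 0 by rewrite -normc_gt0 (lt_le_trans M0).
have -> : w^-1 - v^-1 = (w^-1 * v^-1) * (v - w) by field; rewrite w0 v0.
rewrite !normcM normc_distC; apply: ler_wpM2r; first exact: normc_ge0.
by rewrite expr2 !normcV; apply: ler_pM; rewrite ?invr_ge0 ?normc_ge0// lef_pV2//
  posrE normc_gt0.
Qed.

Lemma normc_product_diff (A B : R) (p p0 q q0 r r0 : R[i]) :
  normc p0 <= A -> normc q <= B -> normc q0 <= B -> normc r <= B -> normc r0 <= B ->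
  normc (p * (q * r) - p0 * (q0 * r0)) <=
    B * B * normc (p - p0) + A * B * normc (q - q0) + A * B * normc (r - r0).
Proof.
move=> pA qB q0B rB r0B.
have -> : p * (q * r) - p0 * (q0 * r0) =
  q * r * (p - p0) + p0 * r * (q - q0) + p0 * q0 * (r - r0) by ring.
apply: le_trans (ler_normcD _ _) _; apply: lerD.
  apply: le_trans (ler_normcD _ _) _; apply: lerD.
    by rewrite !normcM; apply: ler_wpM2r; rewrite ?normc_ge0//; apply: ler_pM; rewrite ?normc_ge0.
  by rewrite !normcM; apply: ler_wpM2r; rewrite ?normc_ge0//; apply: ler_pM; rewrite ?normc_ge0.
by rewrite !normcM; apply: ler_wpM2r; rewrite ?normc_ge0//; apply: ler_pM; rewrite ?normc_ge0.
Qed.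

Lemma normc_near_Im w b (r : R) : normc (w - b) <= r -> Im b - r <= Im w.
Proof.
move=> wb; have := le_trans (ler_normc_Im (w - b)) wb.
by rewrite Im_addc Im_oppc ler_norml => /andP[? ?]; lra.
Qed.

Lemma normc_near w b (r : R) : normc (w - b) <= r -> normc w <= normc b + r.
Proof.
move=> wb; rewrite -[w in leLHS](subrK b) addrC.
by apply: le_trans (ler_normcD _ _) _; rewrite lerD2l.
Qed.

(** Joint Lipschitz continuity, in the measure and in the point, of the Stieltjes
    transform, of [excess] and of its divided difference. *)
Lemma excess_stable mu b : 0 < Im b -> exists r K : R, [/\ 0 < r, 0 <= K &
  forall s nu, levy_dist mu nu < s -> s <= r ->
  forall w v, normc (w - b) <= r -> normc (v - b) <= r ->
  [/\ Im b / 2 <= Im w,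
      normc (stieltjes nu w - stieltjes mu b) <= K * (s + normc (w - b)),
      normc (excess nu w - excess mu b) <= K * (s + normc (w - b))
    & normc (excess_slope nu w v - excess_slope mu b b) <=
        K * (s + normc (w - b) + normc (v - b))]].
Proof.
move=> b0; pose a := Im b / 2; have a0 : 0 < a by rewrite divr_gt0.
have rho0 : 0 <= normc b + a by rewrite addr_ge0 ?normc_ge0// ltW.
have [C C0 HC] := levy_stieltjes a0 rho0.
(* [M] remains a lower bound for the modulus of the perturbed transform when the
   perturbation [2 C1 r] is at most [M]. *)
pose m0 := stieltjes mu b; pose M := normc m0 / 2.
have M0 : 0 < M by rewrite divr_gt0// normc_gt0 stieltjes_neq0.
have ai0 : 0 <= a^-1 by rewrite invr_ge0 ltW.
pose C1 := C + a^-1 * a^-1; have C10 : 0 <= C1 by rewrite addr_ge0// mulr_ge0.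
pose C2 := C + a^-1 ^+ 3; have C20 : 0 <= C2 by rewrite addr_ge0// exprn_ge0.
pose B := M^-1; have B0 : 0 <= B by rewrite invr_ge0 ltW.
pose A := a^-1 * a^-1; have A0 : 0 <= A by rewrite mulr_ge0.
pose r := Num.min a (M / (2 * C1 + 1)).
have D0 : 0 < 2 * C1 + 1 by rewrite ltr_wpDl// mulr_ge0.
have r0 : 0 < r by rewrite lt_min a0 divr_gt0.
pose K1 := B ^+ 2 * C1 + 1; have K10 : 0 <= K1 by rewrite addr_ge0// mulr_ge0// sqr_ge0.
pose K2 := B * B * C2 + A * B * K1 + A * B * K1.
have K20 : 0 <= K2 by rewrite !(mulr_ge0, addr_ge0).
exists r, (C1 + K1 + K2); split => //; first by rewrite addr_ge0// addr_ge0.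
move=> s nu ds sr w v wb vb.
have [s0 _ _] := levy_dist_lt ds; have {}s0 := ltW s0.
have ra : r <= a by rewrite ge_min lexx.
have ab : a <= Im b by rewrite /a; lra.
have nearI u : normc (u - b) <= r -> a <= Im u.
  by move=> /normc_near_Im; apply: le_trans; rewrite /a in ra *; lra.
have nearN u : normc (u - b) <= r -> normc u <= normc b + a.
  by move=> /normc_near /le_trans; apply; rewrite lerD2l.
have aw := nearI _ wb; have av := nearI _ vb.
have [HC1 HC2] := HC _ _ _ ds.
have mE u : normc (u - b) <= r ->
    normc (stieltjes nu u - m0) <= C1 * (s + normc (u - b)).
  move=> ub; have au := nearI _ ub.
  apply: le_trans (normc_dist_triangle (stieltjes mu u) _ _) _.
  rewrite normc_distC.
  have e1 := HC1 u au (nearN _ ub).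
  have e2 : normc (stieltjes mu u - m0) <= A * normc (u - b).
    rewrite /m0 stieltjesB//; last exact: lt_le_trans au.
    rewrite normcM mulrC; apply: ler_wpM2r; first exact: normc_ge0.
    exact: normc_resolvent_product.
  apply: le_trans (lerD e1 e2) _; rewrite /C1 -/A mulrDl !mulrDr.
  have : 0 <= C * normc (u - b) by rewrite mulr_ge0// normc_ge0.
  have : 0 <= A * s by rewrite mulr_ge0.
  lra.
have mM u : normc (u - b) <= r -> M <= normc (stieltjes nu u).
  move=> ub; have := mE _ ub.
  have : C1 * (s + normc (u - b)) <= M.
    apply: (@le_trans _ _ (C1 * (r + r))); first by rewrite ler_wpM2l// lerD.
    have : r * (2 * C1 + 1) <= M by rewrite -ler_pdivlMr// ge_min lexx orbT.
    by move: r0; lra.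
  have := normc_dist_triangle (stieltjes nu u) m0 0; rewrite !subr0 normc_distC.
  by rewrite /M; lra.
have m0M : M <= normc m0 by rewrite /M; move: M0; rewrite /M; lra.
have iE u : normc (u - b) <= r -> normc ((stieltjes nu u)^-1 - m0^-1) <=
    B ^+ 2 * C1 * (s + normc (u - b)).
  move=> ub; apply: le_trans (normc_invB M0 (mM _ ub) m0M) _.
  by rewrite -/B -[leRHS]mulrA; apply: ler_wpM2l; [exact: sqr_ge0|exact: mE].
have iB u : M <= normc u -> normc u^-1 <= B.
  by move=> Mu; rewrite normcV lef_pV2// posrE (lt_le_trans M0).
have ws0 : 0 <= s + normc (w - b) by rewrite addr_ge0// normc_ge0.
split => //.
- apply: le_trans (mE _ wb) _; apply: ler_wpM2r => //.
  by rewrite -addrA lerDl addr_ge0.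
- have -> : excess nu w - excess mu b = (b - w) + (m0^-1 - (stieltjes nu w)^-1).
    by rewrite /excess -/m0; ring.
  apply: le_trans (ler_normcD _ _) _.
  rewrite [normc (b - w)]normc_distC [normc (m0^-1 - _)]normc_distC.
  apply: le_trans (lerD (lexx _) (iE _ wb)) _.
  apply: (@le_trans _ _ (K1 * (s + normc (w - b)))).
    by rewrite /K1 mulrDl mul1r addrC lerD2l lerDr.
  by apply: ler_wpM2r => //; rewrite addrAC lerDr addr_ge0.
have -> : excess_slope nu w v - excess_slope mu b b =
    resolvent_product nu w v * ((stieltjes nu w)^-1 * (stieltjes nu v)^-1) -
    resolvent_product mu b b * (m0^-1 * m0^-1).
  by rewrite /excess_slope -/m0 !invfM; ring.
set e := s + _ + _.
have e0 : 0 <= e by rewrite !addr_ge0// normc_ge0.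
have e1 : s + normc (w - b) <= e by rewrite lerDl normc_ge0.
have e2 : s + normc (v - b) <= e by rewrite /e addrAC lerDl normc_ge0.
apply: le_trans (normc_product_diff _ (normc_resolvent_product mu a0 ab ab)
  (iB _ (mM _ wb)) (iB _ m0M) (iB _ (mM _ vb)) (iB _ m0M)) _.
have p1 : normc (resolvent_product nu w v - resolvent_product mu b b) <= C2 * e.
  apply: le_trans (normc_dist_triangle (resolvent_product mu w v) _ _) _.
  rewrite normc_distC.
  apply: le_trans (lerD (HC2 w v aw (nearN _ wb) av (nearN _ vb))
    (resolvent_product_lip mu a0 aw av ab)) _.
  rewrite /C2 mulrDl; apply: lerD; apply: ler_wpM2l => //; last 2 first.
  - by rewrite exprn_ge0.
  - by rewrite /e -addrA lerDr.
  by rewrite /e -addrA lerDl addr_ge0// normc_ge0.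
have i1 : normc ((stieltjes nu w)^-1 - m0^-1) <= K1 * e.
  apply: le_trans (iE _ wb) _; apply: ler_pM => //.
    by rewrite mulr_ge0// sqr_ge0.
  by rewrite lerDl.
have i2 : normc ((stieltjes nu v)^-1 - m0^-1) <= K1 * e.
  apply: le_trans (iE _ vb) _; apply: ler_pM => //.
  - by rewrite mulr_ge0// sqr_ge0.
  - by rewrite addr_ge0// normc_ge0.
  by rewrite lerDl.
apply: (@le_trans _ _ (K2 * e)); last by apply: ler_wpM2r => //; rewrite lerDr addr_ge0.
rewrite /K2 !mulrDl -!mulrA; apply: lerD; first apply: lerD.
- by rewrite !ler_wpM2l.
- by rewrite -/A; rewrite !ler_wpM2l.
- by rewrite -/A; rewrite !ler_wpM2l.
Qed.

End LocalStability.

(** * Solution of the subordination system near a boundary point *)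

Section NewtonContraction.
Context {R : realType}.
Implicit Types (w v b z : R[i]).

Lemma cvg_of_geometric_steps (u : R^nat) (C : R) :
  (forall n, `|u n.+1 - u n| <= C * 2^-1 ^+ n) -> cvgn u.
Proof.
move=> uC.
have C0 : 0 <= C by have := le_trans (normr_ge0 _) (uC 0%N); rewrite expr0 mulr1.
have : cvgn (series (telescope u)).
  apply: normed_cvg; apply: (@series_le_cvg _ _ (geometric C 2^-1)) => //.
  - by move=> n; exact: normr_ge0.
  - by move=> n; rewrite /geometric /= mulr_ge0// exprn_ge0// invr_ge0.
  - apply: is_cvg_geometric_series.
    by rewrite ger0_norm ?invr_ge0// invf_lt1// ltr1n.
rewrite telescopeK => /(is_cvgD (is_cvg_cst (u 0%N))).
by rewrite (_ : _ + _ = u)//; apply/funext => n /=; rewrite addrC subrK.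
Qed.

Lemma complex_contraction (T : R[i] -> R[i]) b (r : R) : 0 <= r ->
  (forall w v, normc (w - b) <= r -> normc (v - b) <= r ->
    normc (T w - T v) <= normc (w - v) / 2) ->
  normc (T b - b) <= r / 2 ->
  exists2 w, normc (w - b) <= r & T w = w.
Proof.
move=> r0 cT Tb.
have bb : normc (b - b) <= r by rewrite subrr normc0.
have Tin w : normc (w - b) <= r -> normc (T w - b) <= r.
  move=> wb; apply: le_trans (normc_dist_triangle (T b) _ _) _.
  by have := cT _ _ wb bb; lra.
pose u n := iter n T b.
have uin n : normc (u n - b) <= r by elim: n => [|n ih] //=; exact: Tin.
have us n : normc (u n.+1 - u n) <= r * 2^-1 ^+ n.
  elim: n => [|n ih]; first by rewrite expr0 mulr1 /=; lra.
  have := cT _ _ (uin n.+1) (uin n); rewrite exprS.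
  rewrite -/(u n.+2) -/(u n.+1) => H; apply: le_trans H _.
  by rewrite mulrCA (mulrC 2^-1) ler_wpM2r// invr_ge0.
have [cR cI] : cvgn (fun n => Re (u n)) /\ cvgn (fun n => Im (u n)).
  split; apply: (@cvg_of_geometric_steps _ r) => n; apply: le_trans (us n).
    by apply: le_trans (ler_normc_Re _); rewrite Re_addc Re_oppc.
  by apply: le_trans (ler_normc_Im _); rewrite Im_addc Im_oppc.
pose w := (limn (fun n => Re (u n))) +i* (limn (fun n => Im (u n))).
have uw (e : R) : 0 < e -> exists n, normc (u n - w) < e /\ normc (u n.+1 - w) < e.
  move=> e0; have e20 : 0 < e / 2 by rewrite divr_gt0.
  move/cvgrPdist_lt: cR => /(_ _ e20)[n1 _ H1].
  move/cvgrPdist_lt: cI => /(_ _ e20)[n2 _ H2].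
  have H n : (maxn n1 n2 <= n)%N -> normc (u n - w) < e.
    rewrite geq_max => /andP[n1n n2n].
    apply: le_lt_trans (normc_le_ReIm _) _.
    rewrite Re_addc Im_addc Re_oppc Im_oppc /w /= (distrC (Re _)) (distrC (Im _)).
    by have := H1 n n1n; have := H2 n n2n; rewrite /=; lra.
  exists (maxn n1 n2); split; apply: H => //; exact: leqW.
have wb : normc (w - b) <= r.
  apply/ler_addgt0Pr => e /uw[n [une _]].
  apply: le_trans (normc_dist_triangle (u n) _ _) _.
  by rewrite normc_distC addrC lerD// ltW.
exists w => //; apply/eqP; rewrite -subr_eq0; apply/eqP/eq0_normc/eqP.
rewrite eq_le normc_ge0 andbT; apply/ler_addgt0Pr => e e0.
have /uw[n [une uSne]] : 0 < e / 2 by rewrite divr_gt0.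
apply: le_trans (normc_dist_triangle (u n.+1) _ _) _.
have := cT _ _ wb (uin n); rewrite (normc_distC w) -/(u n.+1) => H.
have := normc_ge0 (u n - w).
by rewrite add0r; lra.
Qed.

End NewtonContraction.

Section LocalSolution.
Context {R : realType}.
Implicit Types (mu nu : Rprobability R) (w v b z : R[i]).

(** [w] is the first component of a solution of the subordination system of
    [(mu1, mu2)] at [z]; the second one is [z + excess mu1 w]. *)
Definition subordination_root mu1 mu2 z w : Prop :=
  w = z + excess mu2 (z + excess mu1 w).


(** A simplified Newton iteration, with the derivative at the unperturbed root
    frozen, contracts as soon as that derivative [1 - Q1 Q2] is nonzero.  The
    radius [r] is independent of the perturbation, so that roots at different
    points [z], real ones included, lie in one ball and can be compared: this
    yields the existence of boundary values of the subordination functions of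
    the perturbed pair, and their distance to [b1]. *)
Lemma local_solution mu1 mu2 b1 b2 (x : R[i]) :
  0 < Im b1 -> 0 < Im b2 ->
  b2 = x + excess mu1 b1 -> b1 = x + excess mu2 b2 ->
  1 - excess_slope mu1 b1 b1 * excess_slope mu2 b2 b2 != 0 ->
  exists r d L : R, [/\ 0 < r, 0 < d, 0 <= L &
  forall s nu1 nu2, levy_dist mu1 nu1 < s -> levy_dist mu2 nu2 < s -> s <= d ->
  [/\ forall z, normc (z - x) <= d -> exists w,
        [/\ normc (w - b1) <= r, subordination_root nu1 nu2 z w
          & normc (w - b1) <= L * (s + normc (z - x))],
      forall z w, normc (z - x) <= d -> normc (w - b1) <= r ->
        [/\ Im b1 / 2 <= Im w, 0 < Im (z + excess nu1 w) &
        normc (stieltjes nu1 w - stieltjes mu1 b1) <= L * (s + normc (w - b1))]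
    & forall z z' w w', normc (z - x) <= d -> normc (z' - x) <= d ->
        normc (w - b1) <= r -> normc (w' - b1) <= r ->
        subordination_root nu1 nu2 z w -> subordination_root nu1 nu2 z' w' ->
        normc (w - w') <= L * normc (z - z')]].
Proof.
move=> b10 b20 eb2 eb1; set kap := 1 - _ => kap0.
have [r1 [K1 [r10 K10 H1]]] := excess_stable mu1 b10.
have [r2 [K2 [r20 K20 H2]]] := excess_stable mu2 b20.
set P1 := excess_slope mu1 b1 b1 in kap kap0 *.
set P2 := excess_slope mu2 b2 b2 in kap kap0 *.
pose k := normc kap; have k0 : 0 < k by rewrite normc_gt0.
pose q1 := normc P1; pose q2 := normc P2.
have q10 : 0 <= q1 := normc_ge0 _. have q20 : 0 <= q2 := normc_ge0 _.
(* On the ball of radius [r] the frozen quantities [P1] and [P2] are wrong by at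
   most [r D], and their product by at most half the modulus [k] of the
   derivative. *)
pose D := 3 * K1 + K2 * (3 + 4 * K1).
have D0 : 0 <= D by rewrite !(mulr_ge0, addr_ge0).
(* The residual of the equation at [b1] is at most [N (s + |z - x|)]. *)
pose N := 1 + K2 * (1 + K1).
have N0 : 0 < N by rewrite ltr_wpDr// mulr_ge0// addr_ge0.
pose r := Num.min (Num.min r1 (r2 / (1 + 2 * K1)))
                  (Num.min (1 / (D + 1)) (k / (2 * (D + 1) * (q1 + q2 + 1)))).
have F0 : 0 < 1 + 2 * K1 by rewrite ltr_wpDr// mulr_ge0.
have D1 : 0 < D + 1 by rewrite ltr_wpDl.
have q3 : 0 < q1 + q2 + 1 by rewrite ltr_wpDl// addr_ge0.
have r0 : 0 < r by rewrite !lt_min r10 !divr_gt0// !mulr_gt0.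
have rr1 : r <= r1 by rewrite /r !ge_min lexx.
have rr2 : r * (1 + 2 * K1) <= r2.
  by rewrite -ler_pdivlMr// /r !ge_min lexx orbT.
have rD : r * (D + 1) <= 1 by rewrite -ler_pdivlMr// /r !ge_min lexx !orbT.
have rk : r * (2 * (D + 1) * (q1 + q2 + 1)) <= k.
  by rewrite -ler_pdivlMr ?mulr_gt0// /r !ge_min lexx !orbT.
pose d := Num.min (Num.min r r2) (r * k / (4 * N)).
have d0 : 0 < d by rewrite lt_min [0 < Num.min r r2]lt_min r0 r20 divr_gt0 ?mulr_gt0.
have dr : d <= r by rewrite /d ge_min [Num.min r r2 <= r]ge_min lexx.
have dr1 : d <= r1 := le_trans dr rr1.
have dr2 : d <= r2 by rewrite /d ge_min [Num.min r r2 <= r2]ge_min lexx orbT.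
have dN : d * (4 * N) <= r * k by rewrite -ler_pdivlMr ?mulr_gt0// /d ge_min lexx orbT.
(* One term for the distance of the root to [b1], one for the dependence of the
   root on [z], one for the Stieltjes transform. *)
pose L := 2 * N / k + 2 * (q2 + 2) / k + K1.
have L1 : 0 <= 2 * N / k by rewrite !(divr_ge0, mulr_ge0)// ltW.
have L2 : 0 <= 2 * (q2 + 2) / k by rewrite !(divr_ge0, mulr_ge0, addr_ge0)// ltW.
exists r, d, L; split => //; first by rewrite addr_ge0// addr_ge0.
move=> s nu1 nu2 ds1 ds2 sd.
have s0 : 0 <= s by have [/ltW] := levy_dist_lt ds1.
have sr1 : s <= r1 := le_trans sd dr1. have sr2 : s <= r2 := le_trans sd dr2.
have {}H1 := H1 _ _ ds1 sr1. have {}H2 := H2 _ _ ds2 sr2.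
pose f z w := z + excess nu1 w.
have fb z w : normc (w - b1) <= r ->
    normc (f z w - b2) <= normc (z - x) + K1 * (s + normc (w - b1)).
  move=> wr; have [_ _ hw _] := H1 w w (le_trans wr rr1) (le_trans wr rr1).
  have -> : f z w - b2 = (z - x) + (excess nu1 w - excess mu1 b1).
    by rewrite eb2 /f; ring.
  by apply: le_trans (ler_normcD _ _) _; rewrite lerD2l.
have fr z w : normc (z - x) <= d -> normc (w - b1) <= r ->
    normc (f z w - b2) <= r * (1 + 2 * K1).
  move=> zd wr; apply: le_trans (fb _ _ wr) _.
  have : K1 * (s + normc (w - b1)) <= K1 * (r + r).
    by apply: ler_wpM2l => //; apply: lerD => //; exact: le_trans dr.
  by move: zd dr; clear; lra.
pose q z w z' v := excess_slope nu1 w v * excess_slope nu2 (f z w) (f z' v).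
(* [1 - q] is the divided difference of the function [G] below. *)
have qE z w v : normc (z - x) <= d ->
    normc (w - b1) <= r -> normc (v - b1) <= r ->
    normc (q z w z v - P1 * P2) <= k / 2.
  move=> zd wr vr.
  have [_ _ _ e1] := H1 w v (le_trans wr rr1) (le_trans vr rr1).
  have fwr := fr _ _ zd wr; have fvr := fr _ _ zd vr.
  have [_ _ _ e2] := H2 _ _ (le_trans fwr rr2) (le_trans fvr rr2).
  have {}e1 : normc (excess_slope nu1 w v - P1) <= r * D.
    apply: le_trans e1 _; apply: (@le_trans _ _ (K1 * (r + r + r))).
      by apply: ler_wpM2l => //; rewrite !lerD//; exact: le_trans dr.
    have : 0 <= r * (K2 * (3 + 4 * K1)) by rewrite !(mulr_ge0, addr_ge0)// ltW.
    by rewrite /D; clear; lra.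
  have {}e2 : normc (excess_slope nu2 (f z w) (f z v) - P2) <= r * D.
    apply: le_trans e2 _.
    apply: (@le_trans _ _ (K2 * (r + r * (1 + 2 * K1) + r * (1 + 2 * K1)))).
      by apply: ler_wpM2l => //; rewrite !lerD//; exact: le_trans dr.
    have : 0 <= r * K1 by rewrite mulr_ge0// ltW.
    by rewrite /D; clear; lra.
  have rD0 : 0 <= r * D by rewrite mulr_ge0// ltW.
  have rD1 : r * D <= 1 by move: rD r0; clear; lra.
  have -> : q z w z v - P1 * P2 = (excess_slope nu1 w v - P1) *
      (excess_slope nu2 (f z w) (f z v) - P2) +
      (excess_slope nu1 w v - P1) * P2 +
      P1 * (excess_slope nu2 (f z w) (f z v) - P2) by rewrite /q; ring.
  apply: le_trans (ler_normcD _ _) _.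
  apply: le_trans (lerD (ler_normcD _ _) (lexx _)) _; rewrite !normcM -/q1 -/q2.
  apply: (@le_trans _ _ (r * D * 1 + r * D * q2 + q1 * (r * D))).
    apply: lerD; first apply: lerD.
    - by apply: ler_pM; rewrite ?normc_ge0//; exact: le_trans rD1.
    - exact: ler_wpM2r.
    - exact: ler_wpM2l.
  have : 0 <= r * (q1 + q2 + 1) by rewrite mulr_ge0// ltW.
  by move: rk; clear; lra.
pose G z w := w - z - excess nu2 (f z w).
have fI z w : normc (z - x) <= d -> normc (w - b1) <= r -> 0 < Im (f z w).
  move=> zd wr; have fwr := le_trans (fr _ _ zd wr) rr2.
  have [h _ _ _] := H2 _ _ fwr fwr; apply: lt_le_trans h; exact: divr_gt0.
have wI w : normc (w - b1) <= r -> Im b1 / 2 <= Im w.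
  by move=> wr; have [] := H1 w w (le_trans wr rr1) (le_trans wr rr1).
have wI0 w : normc (w - b1) <= r -> 0 < Im w.
  by move=> /wI; apply: lt_le_trans; exact: divr_gt0.
have GB z w v : normc (z - x) <= d -> normc (w - b1) <= r -> normc (v - b1) <= r ->
    G z w - G z v = (w - v) * (1 - q z w z v).
  move=> zd wr vr.
  have -> : G z w - G z v = (w - v) - (excess nu2 (f z w) - excess nu2 (f z v)).
    by rewrite /G; ring.
  rewrite excessB; [|exact: fI..].
  have -> : f z w - f z v = excess nu1 w - excess nu1 v by rewrite /f; ring.
  by rewrite excessB; [rewrite /q; ring|exact: wI0..].
have b1r : normc (b1 - b1) <= r by rewrite subrr normc0 ltW.
have rootG z w : subordination_root nu1 nu2 z w <-> G z w = 0.
  rewrite /subordination_root /G -/(f z w); split => [{1}->|]; first by ring.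
  by move=> /subr0_eq/eqP; rewrite subr_eq addrC => /eqP.
split.
- move=> z zd.
  pose T w := w - G z w / kap.
  have TB w v : normc (w - b1) <= r -> normc (v - b1) <= r ->
      normc (T w - T v) <= normc (w - v) / 2.
    move=> wr vr.
    have -> : T w - T v = (w - v) - (G z w - G z v) / kap by rewrite /T; field.
    rewrite GB//.
    have -> : w - v - (w - v) * (1 - q z w z v) / kap =
        (w - v) * ((q z w z v - P1 * P2) / kap) by rewrite /kap; field.
    rewrite normcM; apply: ler_wpM2l; first exact: normc_ge0.
    rewrite normcM normcV -/k ler_pdivrMr//.
    by apply: le_trans (qE _ _ _ zd wr vr) _; rewrite mulrC.
  have Gb : normc (G z b1) <= N * (s + normc (z - x)).
    have fbr := le_trans (fr _ _ zd b1r) rr2.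
    have [_ _ h _] := H2 _ _ fbr fbr.
    have -> : G z b1 = (x - z) + (excess mu2 b2 - excess nu2 (f z b1)).
      by rewrite /G {1}eb1; ring.
    apply: le_trans (ler_normcD _ _) _; rewrite normc_distC.
    rewrite [normc (_ - excess _ _)]normc_distC.
    have := fb z b1 b1r; rewrite subrr normc0 addr0 => h'.
    have : K2 * (s + normc (f z b1 - b2)) <= K2 * (s + (normc (z - x) + K1 * s)).
      by rewrite ler_wpM2l// lerD2l.
    have : 0 <= K2 * (K1 * normc (z - x)) by rewrite !mulr_ge0// normc_ge0.
    by move: h s0; rewrite /N; clear; lra.
  have Tb : normc (T b1 - b1) <= N / k * (s + normc (z - x)).
    have -> : T b1 - b1 = - (G z b1 / kap) by rewrite /T; ring.
    rewrite normcN normcM normcV -/k ler_pdivrMr//.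
    by rewrite mulrAC mulfVK ?gt_eqF.
  have Tb2 : normc (T b1 - b1) <= r / 2.
    apply: le_trans Tb _.
    apply: (@le_trans _ _ (N / k * (d + d))).
      by rewrite ler_wpM2l ?divr_ge0 ?(ltW N0) ?(ltW k0)// lerD.
    by rewrite mulrAC ler_pdivrMr//; move: dN; clear; lra.
  have [w wr Tw] := complex_contraction (ltW r0) TB Tb2.
  exists w; split => //.
    apply/rootG; have : G z w / kap = 0.
      by move: Tw => /eqP; rewrite /T subr_eq addrC -subr_eq subrr eq_sym => /eqP.
    by move=> /eqP; rewrite mulf_eq0 invr_eq0 (negbTE kap0) orbF => /eqP.
  have := normc_dist_triangle (T b1) (T w) b1; rewrite {1}Tw => h.
  have h' := TB _ _ wr b1r.
  have sz : 0 <= s + normc (z - x) by rewrite addr_ge0// normc_ge0.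
  have : 2 * N / k * (s + normc (z - x)) <= L * (s + normc (z - x)).
    by rewrite ler_wpM2r// /L; move: L2 K10; clear; lra.
  by move: Tb h h'; clear; lra.
- move=> z w zd wr; split; [exact: wI|exact: fI|].
  have [_ h _ _] := H1 w w (le_trans wr rr1) (le_trans wr rr1).
  apply: le_trans h _; rewrite ler_wpM2r ?addr_ge0 ?normc_ge0// /L.
  by move: L1 L2; clear; lra.
move=> z z' w w' zd z'd wr w'r /rootG Gw /rootG Gw'.
have := GB z w w' zd wr w'r; rewrite Gw sub0r => E1.
have E2 : G z w' = (z' - z) * (1 + excess_slope nu2 (f z w') (f z' w')).
  rewrite -[LHS]subr0 -Gw' /G.
  have -> : w' - z - excess nu2 (f z w') - (w' - z' - excess nu2 (f z' w')) =
    (z' - z) - (excess nu2 (f z w') - excess nu2 (f z' w')) by ring.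
  rewrite excessB; [|exact: fI..].
  by rewrite /f; ring.
have fwr := fr _ _ zd w'r; have fvr := fr _ _ z'd w'r.
have [_ _ _ e2] := H2 _ _ (le_trans fwr rr2) (le_trans fvr rr2).
have {}e2 : normc (excess_slope nu2 (f z w') (f z' w') - P2) <= 1.
  apply: le_trans e2 _.
  apply: (@le_trans _ _ (K2 * (r + r * (1 + 2 * K1) + r * (1 + 2 * K1)))).
    by apply: ler_wpM2l => //; rewrite !lerD//; exact: le_trans dr.
  have : 0 <= r * K1 by rewrite mulr_ge0// ltW.
  by move: rD (ltW r0); rewrite /D; clear; lra.
have nG : normc (G z w') <= (q2 + 2) * normc (z - z').
  rewrite E2 normcM mulrC normc_distC; apply: ler_wpM2r; first exact: normc_ge0.
  have -> : 1 + excess_slope nu2 (f z w') (f z' w') = 1 + (P2 +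
    (excess_slope nu2 (f z w') (f z' w') - P2)) by ring.
  apply: le_trans (ler_normcD _ _) _; rewrite normc1.
  have := ler_normcD P2 (excess_slope nu2 (f z w') (f z' w') - P2).
  by rewrite -/q2; move: e2; clear; lra.
have qk : k / 2 <= normc (1 - q z w z w').
  have := qE _ _ _ zd wr w'r.
  have : k <= normc (1 - q z w z w') + normc (q z w z w' - P1 * P2).
    by apply: le_trans (ler_normcD _ _); rewrite /k /kap addrA subrK.
  by clear; lra.
have : normc (w - w') * (k / 2) <= (q2 + 2) * normc (z - z').
  apply: le_trans nG; rewrite -(normcN (G z w')) E1 normcM.
  by apply: ler_wpM2l => //; exact: normc_ge0.
rewrite mulrA ler_pdivrMr// -ler_pdivlMr// => h; apply: le_trans h _.
have -> : (q2 + 2) * normc (z - z') * 2 / k = (2 * (q2 + 2) / k) * normc (z - z') by ring.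
rewrite ler_wpM2r ?normc_ge0// /L; move: L1 K10; clear; lra.
Qed.

End LocalSolution.

(** * Absolute continuity from bounded Stieltjes transforms *)

Section AbsoluteContinuity.
Context {R : realType}.
Implicit Types (nu : Rprobability R) (x c : R).

(** On the interval of centre [c] and radius [eta] the Poisson kernel of height
    [eta] is at least [1 / (2 eta)]. *)
Lemma interval_mass nu c (eta : R) : 0 < eta ->
  (nu `](c - eta)%R, (c + eta)%R]%classic
     <= (2 * eta * Im (stieltjes nu (c +i* eta)))%:E)%E.
Proof.
move=> e0; set w := c +i* eta; have w0 : 0 < Im w by [].
set I := `](c - eta), (c + eta)]%classic.
have mI : measurable (I : set (measurableTypeR R)) by exact: measurable_itv.
have bw := bounded_measurable_resolvent w0.
have -> : (nu I = (\int[nu]_(t in setT) (\1_I t : R))%:E)%E.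
  by rewrite /Rintegral integral_indic// setIT fineK// fin_num_measure.
have bI := bounded_measurable_Im nu bw.
rewrite lee_fin /= -RintegralZl//.
apply: le_Rintegral => //.
- apply: (@bounded_integrable _ _ _ 1); first exact: measurable_indic.
  by move=> t; rewrite indicE; case: (_ \in _); rewrite ?normr1 ?normr0.
- exact: (@integrableZl _ _ _ nu setT measurableT (2 * eta) _ bI).
move=> t _.
rewrite sub0r sqrrN mulNr opprK.
have D0 : 0 < (t - c) ^+ 2 + eta ^+ 2 by rewrite ltr_wpDl ?sqr_ge0// exprn_gt0.
rewrite indicE; case: (boolP (t \in I)) => [|_]; last first.
  by rewrite !mulr_ge0 ?invr_ge0// ltW.
rewrite inE /I /= in_itv/= => /andP[t1 t2].
rewrite mulrA ler_pdivlMr// mul1r; nra.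
Qed.

Lemma bounded_interval_mass nu x (d C : R) : 0 < d ->
  (forall c (eta : R), `|c - x| < d -> 0 < eta -> Im (stieltjes nu (c +i* eta)) <= C) ->
  forall a b, a < b ->
  (nu (`]a, b]%classic `&` `](x - d)%R, (x + d)%R[%classic) <= (C * (b - a))%:E)%E.
Proof.
move=> d0 HC a b ab.
have C0 : 0 <= C.
  have H : 0 < Im (x +i* 1) by exact: ltr01.
  apply: le_trans (HC x 1 _ _) => //; last by rewrite subrr normr0.
  exact: ltW (Im_stieltjes_gt0 nu H).
(* The part of the interval inside the neighbourhood of [x] is again an interval,
   and its centre satisfies the hypothesis. *)
pose a' := Num.max a (x - d); pose b' := Num.min b (x + d).
have [ab'|ba'] := ltP a' b'; last first.
  rewrite [X in nu X](_ : _ = set0) ?measure0.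
    by rewrite lee_fin mulr_ge0// subr_ge0 ltW.
  apply/seteqP; split => // t /= []; rewrite !in_itv/= => /andP[at_ tb] /andP[xt tx].
  have : a' < t by rewrite gt_max at_.
  have : t <= b' by rewrite le_min tb ltW.
  lra.
have [aa' bb'] : a <= a' /\ b' <= b by rewrite le_max lexx ge_min lexx.
have [xa' xb'] : x - d <= a' /\ b' <= x + d by rewrite le_max lexx ge_min lexx !orbT.
pose eta := (b' - a') / 2; pose c := (a' + b') / 2.
have e0 : 0 < eta by rewrite divr_gt0 ?subr_gt0.
have cE : c - eta = a' by rewrite /c /eta; field.
have cE' : c + eta = b' by rewrite /c /eta; field.
have cx : `|c - x| < d by rewrite ltr_norml; apply/andP; split; rewrite /c; lra.
apply: (@le_trans _ _ (nu `](c - eta)%R, (c + eta)%R]%classic)).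
  rewrite cE cE'; apply: le_measure; rewrite ?inE.
  - by apply: measurableI; exact: measurable_itv.
  - exact: measurable_itv.
  move=> t /= []; rewrite !in_itv/= => /andP[at_ tb] /andP[xt tx].
  by rewrite gt_max at_ xt le_min tb ltW.
apply: le_trans (interval_mass nu c e0) _; rewrite lee_fin.
have h := HC _ _ cx e0.
apply: (@le_trans _ _ (2 * eta * C)); first by rewrite ler_wpM2l// mulr_ge0// ltW.
by rewrite mulrC ler_wpM2l// /eta; lra.
Qed.

(** A null set is covered by half-open intervals of small total length. *)
Lemma abs_continuous_of_bounded nu x (d C : R) : 0 < d ->
  (forall c (eta : R), `|c - x| < d -> 0 < eta -> Im (stieltjes nu (c +i* eta)) <= C) ->
  abs_continuous_near nu x.
Proof.
move=> d0 HC; have HI := bounded_interval_mass d0 HC.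
have C0 : 0 <= C.
  have H : 0 < Im (x +i* 1) by exact: ltr01.
  apply: le_trans (HC x 1 _ _) => //; last by rewrite subrr normr0.
  exact: ltW (Im_stieltjes_gt0 nu H).
pose U : set (measurableTypeR R) := `]x - d, x + d[%classic.
have mU : measurable U by exact: measurable_itv.
exists U, mU; split.
  by apply: near_in_itvoo; rewrite in_itv/= ltrBlDr !ltrDl d0.
apply/null_content_dominatesP => A mA A0; rewrite /mrestr.
apply/eqP; rewrite eq_le measure_ge0 andbT; apply/lee_addgt0Pr => e e0.
rewrite add0e.
have e1 : 0 < e / (C + 1) by rewrite divr_gt0// ltr_wpDl.
have /ereal_inf_lt[z [/= M [mM AM] sMz ze]] :
    ((@lebesgue_measure R) A < (e / (C + 1))%:E)%E by rewrite A0 lte_fin.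
apply: (@le_trans _ _ (\sum_(n <oo) nu (M n `&` U))%E).
  apply: measure_sigma_subadditive.
  - move=> n; apply: measurableI => //.
    exact: sub_sigma_algebra (mM n).
  - exact: measurableI.
  - by rewrite -setI_bigcupl; exact: setSI.
apply: (@le_trans _ _ (\sum_(n <oo) (C%:E * wlength idfun (M n)))%E).
  apply: lee_nneseries => // n _.
  have /ocitvP[->|[[a b] /= ab ->]] : ocitv (M n) by exact: mM.
    by rewrite set0I measure0 wlength0 mule0.
  rewrite wlength_itv_bnd ?(ltW ab)// -EFinM.
  exact: HI.
rewrite nneseriesZl; last by move=> n _; exact: wlength_ge0.
rewrite sMz; apply: (@le_trans _ _ (C%:E * (e / (C + 1))%:E)%E).
  by rewrite lee_wpmul2l ?lee_fin// ltW.
rewrite -EFinM lee_fin mulrA ler_pdivrMr ?ltr_wpDl//.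
by rewrite mulrC ler_wpM2l ?(ltW e0)// lerDl.
Qed.

End AbsoluteContinuity.

(** * Boundary values of the subordination functions *)

Section BoundaryValues.
Context {R : realType}.
Implicit Types (mu nu : Rprobability R) (w v b z : R[i]).

Lemma stieltjes_derivE mu z : 0 < Im z ->
  stieltjes_deriv mu z = resolvent_product mu z z.
Proof.
move=> z0; rewrite /stieltjes_deriv /derive1.
apply: (@cvg_lim (R[i]^o)); first exact: norm_hausdorff.
apply/cvgrPdist_le => e e0.
(* Positive complex numbers are real. *)
have eE : e = (Re e)%:C by apply: eqcP => //=; exact: ger0_Im (ltW e0).
have re0 : 0 < Re e by move: e0; rewrite eE ltcR.
pose a := Im z / 2; have a0 : 0 < a by rewrite divr_gt0.
have K0 : 0 < a^-1 ^+ 3 by rewrite exprn_gt0// invr_gt0.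
pose dl := Num.min a (Re e / a^-1 ^+ 3).
have dl0 : 0 < dl by rewrite lt_min a0 divr_gt0.
have dlC : 0 < dl%:C :> R[i] by rewrite ltcR.
near=> h.
have h0 : h != 0 by near: h; exact: nbhs_dnbhs_neq.
have hd : normc h <= dl.
  by rewrite -lecR; near: h; exact: dnbhs0_le.
have ha : normc (h + z - z) <= a by rewrite addrK; apply: le_trans hd _; rewrite ge_min lexx.
have hz : a <= Im (h + z).
  by apply: le_trans (normc_near_Im ha); rewrite /a; lra.
have az : a <= Im z by rewrite /a; lra.
have -> : h^-1 *: (stieltjes mu (h + z) - stieltjes mu z) = resolvent_product mu (h + z) z.
  rewrite stieltjesB//; last exact: lt_le_trans hz.
  by rewrite addrK; exact: mulKf.
rewrite eE lecR normc_distC.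
apply: le_trans (resolvent_product_lip mu a0 hz az az) _.
rewrite subrr normc0 addr0 addrK mulrC -ler_pdivlMr//.
by apply: le_trans hd _; rewrite ge_min lexx orbT.
Unshelve. all: by end_near. Qed.

Lemma levy_dist_refl mu : levy_dist mu mu = 0.
Proof.
rewrite /levy_dist [X in sup X](_ : _ = [set 0]) ?sup1//.
have I0 t : inf [set s | 0 <= s /\
    dist_fun mu (t - s) - s <= dist_fun mu t <= dist_fun mu (t + s) + s] = 0.
  apply/eqP; rewrite eq_le; apply/andP; split.
    apply: ge_inf; first by exists 0 => s [].
    by split => //; rewrite !subr0 !addr0 lexx.
  apply: lb_le_inf; last by move=> s [].
  by exists 0; split => //; rewrite !subr0 !addr0 lexx.
apply/seteqP; split => [_ [t _ <-]|_ ->] /=; first exact: I0.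
by exists 0.
Qed.

Lemma boundary_value_near (f : R[i] -> R[i]) (x e : R) :
  has_boundary_value f x -> 0 < e ->
  \forall eta \near 0^'+, normc (f (x +i* eta) - boundary_value f x) <= e.
Proof.
move=> hf e0; have eC : 0 < e%:C :> R[i] by rewrite ltcR.
have /cvgrPdist_le/(_ _ eC) := hf.
apply: filterS => eta H; rewrite -lecR normc_distC; exact: H.
Qed.

Lemma subordination_system mu1 mu2 mu (w1 w2 : R[i] -> R[i]) z : 0 < Im z ->
  subordination mu1 mu2 mu w1 w2 ->
  [/\ 0 < Im (w1 z), 0 < Im (w2 z), w2 z = z + excess mu1 (w1 z)
    & w1 z = z + excess mu2 (w2 z)].
Proof.
move=> z0 [[h1 _ _ _] [h2 _ _ _] /(_ z z0)[e1 e2 e3]].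
split; [exact: h1|exact: h2| |].
- by rewrite /excess -e1 addrA e3; ring.
- by rewrite /excess -e2 addrA e3; ring.
Qed.

(** The subordination equation passes to the limit because [excess mu1] is
    continuous at the boundary value, which lies in the open half-plane; the
    continuity is [excess_stable] for a vanishing perturbation. *)
Lemma boundary_system mu1 mu2 mu (w1 w2 : R[i] -> R[i]) (x : R) :
  subordination mu1 mu2 mu w1 w2 ->
  has_boundary_value w1 x -> has_boundary_value w2 x ->
  0 < Im (boundary_value w1 x) ->
  boundary_value w2 x = x%:C + excess mu1 (boundary_value w1 x).
Proof.
move=> sub hb1 hb2; set b1 := boundary_value w1 x; set b2 := boundary_value w2 x.
move=> b10; have [r [K [r0 K0 H]]] := excess_stable mu1 b10.
apply/eqP; rewrite -subr_eq0; apply/eqP/eq0_normc/eqP.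
rewrite eq_le normc_ge0 andbT; apply/ler_addgt0Pr => e e0; rewrite add0r.
pose d := Num.min r (e / (2 + 2 * K)).
have F0 : 0 < 2 + 2 * K by rewrite ltr_pwDl// mulr_ge0.
have d0 : 0 < d by rewrite lt_min r0 divr_gt0.
near (0%R : R)^'+ => eta.
have eta0 : 0 < eta by near: eta; exact: nbhs_right_gt.
have etad : eta <= d by near: eta; exact: nbhs_right_le.
have n1 : normc (w1 (x +i* eta) - b1) <= d.
  by near: eta; exact: boundary_value_near.
have n2 : normc (w2 (x +i* eta) - b2) <= d.
  by near: eta; exact: boundary_value_near.
have dr : d <= r by rewrite ge_min lexx.
have d1 : levy_dist mu1 mu1 < d by rewrite levy_dist_refl.
have n1r := le_trans n1 dr.
have [_ _ h _] := H _ _ d1 dr _ _ n1r n1r.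
have [_ _ sys _] := subordination_system (z := x +i* eta) eta0 sub.
apply: le_trans (normc_dist_triangle (w2 (x +i* eta)) _ _) _.
rewrite normc_distC.
have -> : w2 (x +i* eta) - (x%:C + excess mu1 b1) =
    (0 +i* eta) + (excess mu1 (w1 (x +i* eta)) - excess mu1 b1).
  have -> : 0 +i* eta = (x +i* eta) - x%:C by apply: eqcP => /=; ring.
  by rewrite sys; ring.
have ne : normc (0 +i* eta) = eta.
  by rewrite /normc expr0n/= add0r sqrtr_sqr gtr0_norm.
have := ler_normcD (0 +i* eta) (excess mu1 (w1 (x +i* eta)) - excess mu1 b1).
have : K * (d + normc (w1 (x +i* eta) - b1)) <= K * (d + d).
  by rewrite ler_wpM2l// lerD2l.
have : d * (2 + 2 * K) <= e by rewrite -ler_pdivlMr// ge_min lexx orbT.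
by rewrite ne; lra.
Unshelve. all: by end_near. Qed.

Lemma subordinationC mu1 mu2 mu (w1 w2 : R[i] -> R[i]) :
  subordination mu1 mu2 mu w1 w2 -> subordination mu2 mu1 mu w2 w1.
Proof.
move=> [h1 h2 h]; split => // z /h[e1 e2 e3]; split => //.
by rewrite e3 addrC.
Qed.

(** The quantity [k_mu] of the smoothness condition is, up to a nonzero factor,
    the Jacobian [1 - h1' h2'] of the fixed-point equation, [hj] being the
    excess functions. *)
Lemma kfun_neq0 mu1 mu2 (x : R) b1 b2 : 0 < Im b1 -> 0 < Im b2 ->
  b2 = x%:C + excess mu1 b1 -> b1 = x%:C + excess mu2 b2 ->
  stieltjes_deriv mu1 b1 != 0 -> stieltjes_deriv mu2 b2 != 0 ->
  kfun mu1 mu2 x b1 b2 != 0 ->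
  1 - excess_slope mu1 b1 b1 * excess_slope mu2 b2 b2 != 0.
Proof.
move=> b10 b20 e1 e2; rewrite /kfun !stieltjes_derivE// /excess_slope.
set P1 := resolvent_product mu1 _ _; set P2 := resolvent_product mu2 _ _.
move=> P10 P20.
have m10 := stieltjes_neq0 mu1 b10; have m20 := stieltjes_neq0 mu2 b20.
have E1 : (stieltjes mu1 b1)^-1 = x%:C - b1 - b2 by rewrite e1 /excess; ring.
have E2 : (stieltjes mu2 b2)^-1 = x%:C - b1 - b2 by rewrite {1}e2 /excess; ring.
have m12 : stieltjes mu2 b2 = stieltjes mu1 b1 by apply: invr_inj; rewrite E1 E2.
rewrite -E1 m12; set m := stieltjes mu1 b1 in m10 *.
apply: contraNN => /eqP k0; apply/eqP.
have -> : P1^-1 + P2^-1 - m^-1 ^+ 2 = m ^+ 2 / (P1 * P2) *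
   (1 - (P1 / (m * m) - 1) * (P2 / (m * m) - 1)).
  by field; rewrite P10 P20 m10.
by rewrite k0 mulr0.
Qed.

End BoundaryValues.

(** * Density of the free convolution *)

Section FreeDensity.
Context {R : realType}.
Implicit Types (mu nu : Rprobability R) (w z : R[i]).

(** A bounded family of roots reaching the real axis controls the free
    convolution near [x]: by uniqueness the roots are the values of the
    subordination function. *)
Lemma free_convolution_near (nu1 nu2 nu : Rprobability R) (x : R) (b1 : R[i])
    (r d a L : R) : 0 < d -> 0 < a -> 0 <= L ->
  (forall z, normc (z - x%:C) <= d ->
    exists2 w, normc (w - b1) <= r & subordination_root nu1 nu2 z w) ->
  (forall z w, normc (z - x%:C) <= d -> normc (w - b1) <= r ->
    a <= Im w /\ 0 < Im (z + excess nu1 w)) ->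
  (forall z z' w w', normc (z - x%:C) <= d -> normc (z' - x%:C) <= d ->
    normc (w - b1) <= r -> normc (w' - b1) <= r ->
    subordination_root nu1 nu2 z w -> subordination_root nu1 nu2 z' w' ->
    normc (w - w') <= L * normc (z - z')) ->
  is_free_convolution nu1 nu2 nu ->
  abs_continuous_near nu x /\
  forall w0, normc (w0 - b1) <= r -> subordination_root nu1 nu2 x%:C w0 ->
    Im (stieltjes nu (x +i* eta)) @[eta --> 0^'+] --> Im (stieltjes nu1 w0).
Proof.
move=> d0 a0 L0 ex bd lip [v1 [v2 sub]].
have root z : 0 < Im z -> normc (z - x%:C) <= d ->
    exists w, [/\ normc (w - b1) <= r, subordination_root nu1 nu2 z w &
      stieltjes nu z = stieltjes nu1 w].
  move=> z0 zd; have [w wr ew] := ex z zd; exists w; split => //.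
  have [aw fw] := bd _ _ zd wr.
  have [p1 p2 s1 s2] := subordination_system z0 sub.
  have [_ _ /(_ z z0)[-> _ _]] := sub.
  by have [-> _] := subordination_unique z0 p1 p2 (lt_le_trans a0 aw) fw s1 s2 erefl ew.
have dist_x (c eta : R) : 0 < eta -> normc ((c +i* eta) - x%:C) <= `|c - x| + eta.
  by move=> e0; apply: le_trans (normc_le_ReIm _) _; rewrite /= subr0 (gtr0_norm e0).
split.
  apply: (@abs_continuous_of_bounded _ _ _ (d / 2) (a^-1 + (d / 2)^-1)).
    exact: divr_gt0.
  move=> c eta cx e0; have iz : 0 < Im (c +i* eta) by [].
  (* Close to the axis the transform is that of [nu1] at a root, whose imaginary
     part is at least [a]; far from it [|m| <= 1 / eta] suffices. *)
  have [ed|de] := leP eta (d / 2).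
    have [|w [wr _ ->]] := root _ iz.
      by apply: le_trans (dist_x _ _ e0) _; lra.
    have [aw _] : a <= Im w /\ 0 < Im (x%:C + excess nu1 w).
      by apply: bd => //; rewrite subrr normc0 ltW.
    have w0 := lt_le_trans a0 aw.
    apply: le_trans (ler_norm _) _; apply: le_trans (ler_normc_Im _) _.
    apply: le_trans (normc_stieltjes nu1 w0) _.
    have : (Im w)^-1 <= a^-1 by rewrite lef_pV2.
    have : 0 < (d / 2)^-1 by rewrite invr_gt0 divr_gt0.
    lra.
  apply: le_trans (ler_norm _) _; apply: le_trans (ler_normc_Im _) _.
  apply: le_trans (normc_stieltjes nu iz) _.
  have : eta^-1 <= (d / 2)^-1 by rewrite lef_pV2 ?posrE ?divr_gt0// ltW.
  have : 0 < a^-1 by rewrite invr_gt0.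
  rewrite /=; lra.
move=> w0 w0r ew0; apply/cvgrPdist_le => e e0.
pose K := a^-1 * a^-1 * L + 1.
have K0 : 0 < K by rewrite ltr_wpDl// !mulr_ge0// invr_ge0 ltW.
have eK : 0 < e / K by rewrite divr_gt0.
near=> eta.
have eta0 : 0 < eta by near: eta; exact: nbhs_right_gt.
have etad : eta <= d by near: eta; exact: nbhs_right_le.
have etae : eta <= e / K by near: eta; exact: nbhs_right_le.
have iz : 0 < Im (x +i* eta) by [].
have zx : normc ((x +i* eta) - x%:C) <= eta.
  by apply: le_trans (dist_x _ _ eta0) _; rewrite subrr normr0 add0r.
have zd := le_trans zx etad.
have xd : normc (x%:C - x%:C) <= d by rewrite subrr normc0 ltW.
have [w [wr ew ->]] := root _ iz zd.
have [aw _] := bd _ _ zd wr; have [aw0 _] := bd _ _ zd w0r.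
have h := lip _ _ _ _ zd xd wr w0r ew ew0.
apply: (@le_trans _ _ (normc (stieltjes nu1 w - stieltjes nu1 w0))).
  by rewrite distrC; apply: le_trans (ler_normc_Im _); rewrite Im_addc Im_oppc.
rewrite stieltjesB; [|exact: lt_le_trans aw|exact: lt_le_trans aw0].
rewrite normcM mulrC.
apply: le_trans (ler_pM (normc_ge0 _) (normc_ge0 _)
  (normc_resolvent_product nu1 a0 aw aw0) h) _.
apply: (@le_trans _ _ (K * eta)); last by rewrite mulrC -ler_pdivlMr.
rewrite mulrA; apply: (@le_trans _ _ (a^-1 * a^-1 * L * eta)).
  by apply: ler_wpM2l => //; rewrite !mulr_ge0// invr_ge0 ltW.
by rewrite ler_wpM2r ?(ltW eta0)// lerDl.
Unshelve. all: by end_near. Qed.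

End FreeDensity.

Theorem theorem1p3 (R : realType) (mu1 mu2 : Rprobability R) (x : R) :
  smooth_at mu1 mu2 x ->
  exists s0 c : R, [/\ 0 < s0, 0 < c &
    forall s : R, 0 < s -> s <= s0 ->
    forall nu1 nu2 : Rprobability R,
      levy_dist mu1 nu1 < s -> levy_dist mu2 nu2 < s ->
    forall mu nu : Rprobability R,
      is_free_convolution mu1 mu2 mu -> is_free_convolution nu1 nu2 nu ->
      [/\ abs_continuous_near nu x,
          has_density_value nu x,
          has_density_value mu x
        & `|density_value nu x - density_value mu x| < c * s]].
Proof.
move=> [mu0 [w1 [w2 [sub]]]] /=.
set b1 := boundary_value w1 x; set b2 := boundary_value w2 x.
move=> [[hb1 hb2] [b10 b20] [D1 D2] kf].
have e2 : b2 = x%:C + excess mu1 b1 by exact: boundary_system sub hb1 hb2 b10.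
have e1 : b1 = x%:C + excess mu2 b2.
  exact: boundary_system (subordinationC sub) hb2 hb1 b20.
have kap0 := kfun_neq0 b10 b20 e2 e1 D1 D2 kf.
have [r [d [L [r0 d0 L0 H]]]] := local_solution b10 b20 e2 e1 kap0.
have a0 : 0 < Im b1 / 2 by rewrite divr_gt0.
have xd : normc (x%:C - x%:C) <= d by rewrite subrr normc0 ltW.
have near_x s nu1 nu2 nu : levy_dist mu1 nu1 < s -> levy_dist mu2 nu2 < s ->
    s <= d -> is_free_convolution nu1 nu2 nu ->
    abs_continuous_near nu x /\
    forall w0, normc (w0 - b1) <= r -> subordination_root nu1 nu2 x%:C w0 ->
    Im (stieltjes nu (x +i* eta)) @[eta --> 0^'+] --> Im (stieltjes nu1 w0).
  move=> ds1 ds2 sd; have [ex bd lip] := H _ _ _ ds1 ds2 sd.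
  apply: (@free_convolution_near _ nu1 nu2 nu x b1 r d (Im b1 / 2) L) => //.
    by move=> z /ex[w [? ? _]]; exists w.
  by move=> z w zd /(bd z w zd)[].
have pi0 : 0 < pi^-1 :> R by rewrite invr_gt0 pi_gt0.
exists d, (pi^-1 * (L * (1 + L)) + 1); split => //.
  by rewrite ltr_wpDl// !mulr_ge0 ?addr_ge0// ltW.
move=> s s0 sd nu1 nu2 ds1 ds2 mu nu cmu cnu.
have dm1 : levy_dist mu1 mu1 < d by rewrite levy_dist_refl.
have dm2 : levy_dist mu2 mu2 < d by rewrite levy_dist_refl.
have [_ cvmu] := near_x _ _ _ _ dm1 dm2 (lexx d) cmu.
have [ac cvnu] := near_x _ _ _ _ ds1 ds2 sd cnu.
have b1r : normc (b1 - b1) <= r by rewrite subrr normc0 ltW.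
(* For the unperturbed pair the root at [x] is [b1] itself. *)
have {}cvmu : Im (stieltjes mu (x +i* eta)) @[eta --> 0^'+] --> Im (stieltjes mu1 b1).
  by apply: cvmu => //; rewrite /subordination_root -e2.
have [ex bd _] := H _ _ _ ds1 ds2 sd.
have [w [wr ew wL]] := ex _ xd.
have [_ _ mL] := bd _ _ xd wr.
have {}cvnu := cvnu w wr ew.
split => //; [by apply/cvg_ex; eexists; exact: cvnu|by apply/cvg_ex; eexists; exact: cvmu|].
rewrite /density_value (cvg_lim _ cvnu)// (cvg_lim _ cvmu)//.
rewrite -mulrBr normrM (gtr0_norm pi0) mulrDl mul1r -mulrA.
apply: (@le_lt_trans _ _ (pi^-1 * (L * (1 + L) * s))); last by rewrite ltrDl.
apply: ler_wpM2l; first exact: ltW.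
apply: (@le_trans _ _ (normc (stieltjes nu1 w - stieltjes mu1 b1))).
  by apply: le_trans (ler_normc_Im _); rewrite Im_addc Im_oppc.
apply: le_trans mL _; rewrite -mulrA; apply: ler_wpM2l => //.
rewrite subrr normc0 addr0 in wL.
by rewrite mulrDl mul1r lerD2l.
Qed.
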